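(* Let $(X,d_X,\mu,T)$ and $(Y,d_Y,\nu,S)$ be compact metric measure-preserving systems and let $\lambda,\lambda'\in\mathcal J(T,S)$. If $\Phi_{n,m}(\lambda)=\Phi_{n,m}(\lambda')$ for every $n,m\ge1$, then the twin-free quotients $\mathcal K_\lambda^{\rm tw}$ and $\mathcal K_{\lambda'}^{\rm tw}$ are kernel-isomorphic. If, in addition, $\lambda$ and $\lambda'$ are distance-array pure, then there is a measure-space isomorphism $U:(X\times Y,\lambda)\to(X\times Y,\lambda')$ such that for all $a,b\ge0$: $M_X^{a,b}(z)=M_X^{a,b}(Uz)$ and $M_Y^{a,b}(z)=M_Y^{a,b}(Uz)$ for $\lambda$-a.e. $z$, and $K_X^{a,b}(z,z')=K_X^{a,b}(Uz,Uz')$ and $K_Y^{a,b}(z,z')=K_Y^{a,b}(Uz,Uz')$ for $\lambda\otimes\lambda$-a.e. $(z,z')$.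
   Context: A compact metric measure-preserving system $(X,d_X,\mu,T)$: $(X,d_X)$ compact metric, $\mu$ Borel probability, $T$ Borel with $T_\#\mu=\mu$; all probability spaces are standard and completed, equalities are modulo null sets. $\mathcal J(T,S)$ is the set of joinings: Borel probability measures on $X\times Y$ with marginals $\mu,\nu$ invariant under $T\times S$. For $z_i=(x_i,y_i)$, $\mathcal D^X_{n,m}=(d_X(T^ax_i,T^bx_j))_{1\le i,j\le n,0\le a,b<m}$, $\mathcal D^Y_{n,m}=(d_Y(S^ay_i,S^by_j))_{1\le i,j\le n,0\le a,b<m}$, and $\Phi_{n,m}(\lambda)=\mathrm{Law}_{\lambda^{\otimes n}}(\mathcal D^X_{n,m},\mathcal D^Y_{n,m})$. For $\lambda\in\mathcal J(T,S)$, $\mathcal K_\lambda$ is the marked colored kernel space on $(X\times Y,\lambda)$ with marks $M_X^{a,b}(x,y)=d_X(T^ax,T^bx)$, $M_Y^{a,b}(x,y)=d_Y(S^ay,S^by)$ and kernels $K_X^{a,b}((x,y),(x',y'))=d_X(T^ax,T^bx')$, $K_Y^{a,b}((x,y),(x',y'))=d_Y(S^ay,S^by')$, $a,b\ge0$. In a marked colored kernel space $(\Omega,\rho,(m_\alpha),(k_c))$ (countably many bounded measurable marks $m_\alpha:\Omega\to\mathbb R$ and kernels $k_c:\Omega^2\to\mathbb R$), points $z,z'$ are twins if all marks agree at $z,z'$ and for every $c$, $k_c(z,w)=k_c(z',w)$ and $k_c(w,z)=k_c(w,z')$ for $\rho$-a.e. $w$; the space is row-column-mark pure if, after discarding a null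 set, no two distinct points are twins. $\lambda$ is distance-array pure if $\mathcal K_\lambda$ is row-column-mark pure. The twin-free quotient $\mathcal K^{\rm tw}$ is the row-column-mark pure marked colored kernel space obtained (modulo null sets) by identifying twins, with the pushforward measure and the marks and kernels descended to the quotient. Two marked colored kernel spaces are kernel-isomorphic if a measure-space isomorphism $U$ between them preserves each mark a.e. and each kernel $\rho\otimes\rho$-a.e. *)

(* Defs.v *)
From HB Require Import structures.
From mathcomp Require Import all_boot all_order all_algebra.
From mathcomp Require Import all_classical all_reals all_analysis.
Unset Printing Implicit Defensive.
Import Order.TTheory GRing.Theory Num.Theory.
Local Open Scope classical_set_scope.
Local Open Scope ring_scope.

Section metric.
Context {R : realType} {d : measure_display} {X : measurableType d}.

Definition is_metric (dist : X -> X -> R) : Prop :=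
  [/\ (forall x y, 0 <= dist x y),
      (forall x y, dist x y = 0 <-> x = y),
      (forall x y, dist x y = dist y x) &
      (forall x y z, dist x z <= dist x y + dist y z)].

Definition metric_open (dist : X -> X -> R) (A : set X) : Prop :=
  forall x, A x -> exists2 r : R, 0 < r & [set y | dist x y < r] `<=` A.

Definition metric_compact (dist : X -> X -> R) : Prop :=
  forall (I : Type) (U : I -> set X),
    (forall i, metric_open dist (U i)) -> \bigcup_i U i = setT ->
    exists s : seq I, \big[setU/set0]_(i <- s) U i = setT.

Definition metric_borel (dist : X -> X -> R) : Prop :=
  @measurable d X = <<s metric_open dist >>.

Definition cmmps (dist : X -> X -> R) (mu : probability X R) (T : X -> X) : Prop :=
  [/\ is_metric dist, metric_compact dist, metric_borel dist,
      measurable_fun setT T &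
      (forall A, measurable A -> mu (T @^-1` A) = mu A)].
End metric.

Definition joining {R : realType} {dx dy : measure_display}
  {X : measurableType dx} {Y : measurableType dy}
  (mu : probability X R) (T : X -> X) (nu : probability Y R) (S : Y -> Y)
  (lam : probability (X * Y)%type R) : Prop :=
  [/\ (forall A, measurable A -> lam (A `*` setT) = mu A),
      (forall B, measurable B -> lam (setT `*` B) = nu B) &
      (forall C, measurable C ->
         lam ((fun z : X * Y => (T z.1, S z.2)) @^-1` C) = lam C)].

Section arrays.
Context {R : realType} {dx dy : measure_display}
  {X : measurableType dx} {Y : measurableType dy}.

(** index set of the pair of arrays (D^X_{n,m}, D^Y_{n,m}):
    [(false,i,j,a,b)] indexes D^X and [(true,i,j,a,b)] indexes D^Y,
    with [i j : 'I_n] standing for 1 <= i,j <= n and [a b : 'I_m] for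
    0 <= a,b < m. *)
Definition arr_index (n m : nat) := (bool * 'I_n * 'I_n * 'I_m * 'I_m)%type.

Definition dist_arrays (dX : X -> X -> R) (T : X -> X) (dY : Y -> Y -> R)
  (S : Y -> Y) (n m : nat) (z : 'I_n -> X * Y) : arr_index n m -> R :=
  fun k => let: (c, i, j, a, b) := k in
    if c then dY (iter a S (z i).2) (iter b S (z j).2)
    else dX (iter a T (z i).1) (iter b T (z j).1).

Definition arr_measurable (n m : nat) : set (set (arr_index n m -> R)) :=
  <<s [set C | exists k (A : set R), measurable A /\
                 C = (fun f : arr_index n m -> R => f k) @^-1` A] >>.
End arrays.

(** The n-fold product measure lam^{(x) n} of a probability measure,
    computed by iterated integration (Fubini-Tonelli). *)
Section nfold.
Context {R : realType} {d : measure_display} {Z : measurableType d}.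
Local Open Scope ereal_scope.

Fixpoint iter_integral (P : probability Z R) (k : nat)
  (f : (nat -> Z) -> \bar R) (z : nat -> Z) : \bar R :=
  match k with
  | 0 => f z
  | k'.+1 => \int[P]_w iter_integral P k' f
                (fun j => if j == k' then w else z j)
  end.

Definition nfold_prod (P : probability Z R) (n : nat)
  (C : set ('I_n -> Z)) : \bar R :=
  iter_integral P n
    (fun z => (\1_C (fun i : 'I_n => z (nat_of_ord i)) : R)%:E)
    (fun _ => point).
End nfold.

Section Phi.
Context {R : realType} {dx dy : measure_display}
  {X : measurableType dx} {Y : measurableType dy}.

Definition Phi (dX : X -> X -> R) (T : X -> X) (dY : Y -> Y -> R) (S : Y -> Y)
  (n m : nat) (lam : probability (X * Y)%type R)
  (B : set (arr_index n m -> R)) : \bar R :=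
  nfold_prod lam n (dist_arrays dX T dY S n m @^-1` B).

Definition Phi_eq (dX : X -> X -> R) (T : X -> X) (dY : Y -> Y -> R)
  (S : Y -> Y) (n m : nat) (lam lam' : probability (X * Y)%type R) : Prop :=
  forall B, arr_measurable n m B ->
    Phi dX T dY S n m lam B = Phi dX T dY S n m lam' B.
End Phi.

Record mck_space (R : realType) (I J : Type) := MCK {
  mck_disp : measure_display;
  mck_T : measurableType mck_disp;
  mck_P : probability mck_T R;
  mck_mark : I -> mck_T -> R;
  mck_ker : J -> mck_T -> mck_T -> R }.

Arguments MCK {R I J mck_disp mck_T}.
Arguments mck_T {R I J}.
Arguments mck_P {R I J}.
Arguments mck_mark {R I J}.
Arguments mck_ker {R I J}.

Section mck.
Context {R : realType} {I J : Type}.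
Local Open Scope ereal_scope.

Definition wf_mck (K : mck_space R I J) : Prop :=
  [/\ (exists f : I -> nat, injective f) /\ (exists g : J -> nat, injective g),
      (forall alpha, measurable_fun setT (mck_mark K alpha)),
      (forall alpha, exists M : R, forall z, (`|mck_mark K alpha z| <= M)%R),
      (forall c, measurable_fun setT
                   (fun p : mck_T K * mck_T K => mck_ker K c p.1 p.2)) &
      (forall c, exists M : R, forall z w, (`|mck_ker K c z w| <= M)%R)].

Definition twins (K : mck_space R I J) (z z' : mck_T K) : Prop :=
  (forall alpha, mck_mark K alpha z = mck_mark K alpha z') /\
  (forall c, {ae mck_P K, forall w,
     mck_ker K c z w = mck_ker K c z' w /\ mck_ker K c w z = mck_ker K c w z'}).

Definition rcm_pure (K : mck_space R I J) : Prop :=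
  exists N : set (mck_T K), (mck_P K).-negligible N /\
    forall z z', ~ N z -> ~ N z' -> twins K z z' -> z = z'.

Definition mspace_iso {d1 d2 : measure_display}
  {T1 : measurableType d1} {T2 : measurableType d2}
  (P1 : probability T1 R) (P2 : probability T2 R) (U : T1 -> T2) : Prop :=
  [/\ measurable_fun setT U,
      (forall A, measurable A -> P1 (U @^-1` A) = P2 A) &
      exists V : T2 -> T1,
        [/\ measurable_fun setT V,
            (forall A, measurable A -> P2 (V @^-1` A) = P1 A),
            {ae P1, forall x, V (U x) = x} &
            {ae P2, forall y, U (V y) = y}]].

Definition kernel_iso_via (K1 K2 : mck_space R I J)
  (U : mck_T K1 -> mck_T K2) : Prop :=
  [/\ mspace_iso (mck_P K1) (mck_P K2) U,
      (forall alpha, {ae mck_P K1, forall z,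
                        mck_mark K1 alpha z = mck_mark K2 alpha (U z)}) &
      (forall c, {ae (mck_P K1 \x mck_P K1), forall p : mck_T K1 * mck_T K1,
                    mck_ker K1 c p.1 p.2 = mck_ker K2 c (U p.1) (U p.2)})].

Definition kernel_isomorphic (K1 K2 : mck_space R I J) : Prop :=
  exists U, kernel_iso_via K1 K2 U.

Definition twin_free_quotient (K Q : mck_space R I J)
  (pi : mck_T K -> mck_T Q) : Prop :=
  [/\ wf_mck Q /\ rcm_pure Q,
      (forall q, exists z, pi z = q) /\
      (forall z z', pi z = pi z' <-> twins K z z'),
      (forall A : set (mck_T Q), measurable A <-> measurable (pi @^-1` A)) /\
      (forall A, measurable A -> mck_P Q A = mck_P K (pi @^-1` A)),
      (forall alpha z, mck_mark K alpha z = mck_mark Q alpha (pi z)) &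
      (forall c, {ae (mck_P K \x mck_P K), forall p : mck_T K * mck_T K,
                    mck_ker K c p.1 p.2 = mck_ker Q c (pi p.1) (pi p.2)})].
End mck.

Section Klam.
Context {R : realType} {dx dy : measure_display}
  {X : measurableType dx} {Y : measurableType dy}.

Definition K_lam (dX : X -> X -> R) (T : X -> X) (dY : Y -> Y -> R)
  (S : Y -> Y) (lam : probability (X * Y)%type R)
  : mck_space R (bool * nat * nat) (bool * nat * nat) :=
  MCK lam
    (fun k z => let: (c, a, b) := k in
       if c then dY (iter a S z.2) (iter b S z.2)
       else dX (iter a T z.1) (iter b T z.1))
    (fun k z z' => let: (c, a, b) := k in
       if c then dY (iter a S z.2) (iter b S z'.2)
       else dX (iter a T z.1) (iter b T z'.1)).

Definition distance_array_pure (dX : X -> X -> R) (T : X -> X)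
  (dY : Y -> Y -> R) (S : Y -> Y) (lam : probability (X * Y)%type R) : Prop :=
  rcm_pure (K_lam dX T dY S lam).
End Klam.

(* Main.v *)
(** Put Z = X * Y with the two pseudo-metrics d_X and d_Y, and let (w_l) be dense
in the support of lambda.  For a test function
G(u) = \int \prod h(d_c(T^a z, u_l)) dlambda(z), the moments of 1 - (G - g)^2
under lambda^n are integrals of functions of the arrays, so they are the same for
lambda'.  Comparing the growth rates of high moments of a product of such factors
shows that finitely many values G(w) can be approximated by the corresponding
values for lambda', and an ultrafilter limit in the compact space Z gives a
sequence (w'_l) realising all of them exactly.  Hence the profile
z |-> (d_c(T^a z, w_l))_{c,a,l} under lambda and its analogue for w' under lambda'
have the same law.  Since the coordinates a = 0 of the profile determine z on the
closure of (w_l), matching profiles defines the isomorphism U; the other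
coordinates are almost surely functions of those, which makes U compatible with
all kernels.

A twin of a point of the support of lambda is equal to that point, so the twin-free
quotient map is itself an isomorphism modulo null sets, and purity is automatic. *)

Require Import Defs.
From HB Require Import structures.
From mathcomp Require Import all_boot all_order all_algebra.
From mathcomp Require Import all_classical all_reals all_analysis.
From mathcomp Require Import measurable_realfun ring lra zify.
Set Implicit Arguments.
Unset Strict Implicit.
Unset Printing Implicit Defensive.
Import Order.TTheory GRing.Theory Num.Theory.
Local Open Scope classical_set_scope.
Local Open Scope ring_scope.

(** * Iterated integrals as integrals against a law *)

(** [T] and [S] are only Borel, so iterates have no continuity and limits can be taken only in
    points that are not iterated. Hence a test pairs the integrated point [T^a z] with a bare
    reference point [u_l], and its mean [G] is Lipschitz in [u]. [G(u)] depends on the measure and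
    is not itself a function of an array. But if [H] is the test and [v], [v'] are two fresh
    independent points, then [1 - (H(v) - g)(H(v') - g)] is a nonnegative function of the array,
    whose integral is [1 - (G(u) - g)^2] for whichever measure is used. The constants [g] are
    numbers computed from lambda, so one integrand serves both measures. Its product over the tests
    is close to 1 for reference points in a box around [w], whose mass is positive because [w] lies
    in the support and does not depend on the exponent; if no sequence matched under lambda', the
    same product would stay below a smaller constant everywhere. Iterates of the second point return
    only at the end: by invariance almost every orbit is adherent to the reference sequence, so
    [T^b z'] can be replaced by a nearby [w_l]. *)

Section cylinders.
Context {I : Type} {d : measure_display} {Z : measurableType d}.

Definition cylinders : set (set (I -> Z)) :=
  [set C | exists k (A : set Z), measurable A /\ C = (fun f : I -> Z => f k) @^-1` A].

Definition cylinderT := g_sigma_algebraType cylinders.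

Lemma measurable_coord (i : I) : measurable_fun setT (fun f : cylinderT => f i).
Proof.
move=> _ A mA; rewrite setTI; apply: sub_sigma_algebra.
by exists i, A.
Qed.

Lemma measurable_cylinderT d' (O : measurableType d') (F : O -> cylinderT) :
  (forall i, measurable_fun setT (fun o => F o i)) -> measurable_fun setT F.
Proof.
move=> mF; apply: (@measurability _ _ O cylinderT setT F cylinders) => //.
move=> _ [_ [i [A [mA ->]]] <-].
exact: (mF i measurableT _ mA).
Qed.
End cylinders.
Arguments cylinderT I {d} Z.

Section iterated_integral.
Context {R : realType} {d : measure_display} {Z : measurableType d}.
Variable P : probability Z R.
Local Notation W := (cylinderT nat Z).
Local Open Scope ereal_scope.

Definition upd (k : nat) (w : Z) (z : nat -> Z) : nat -> Z :=
  fun j => if j == k then w else z j.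

Lemma updC k m w v z : k != m -> upd k w (upd m v z) = upd m v (upd k w z).
Proof.
move=> km; apply/funext => j; rewrite /upd.
by case: (eqVneq j k) => [->|//]; rewrite (negbTE km).
Qed.

Definition upd_pair k (p : Z * W) : W := upd k p.1 p.2.

Lemma measurable_upd_pair k : measurable_fun setT (upd_pair k).
Proof.
apply: measurable_cylinderT => i; rewrite /upd_pair /upd.
case: (i == k); first exact: measurable_fst.
exact: (measurableT_comp (measurable_coord i) measurable_snd).
Qed.

HB.instance Definition _ k := isMeasurableFun.Build _ _ _ _
  (upd_pair k) (measurable_upd_pair k).

Lemma measurable_upd k (z : W) : measurable_fun setT (fun w => upd k w z : W).
Proof.
by apply: measurable_cylinderT => i; rewrite /upd; case: (i == k).
Qed.

Lemma measurable_updr k w : measurable_fun setT (fun z : W => upd k w z : W).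
Proof.
apply: measurable_cylinderT => i; rewrite /upd; case: (i == k) => //.
exact: measurable_coord.
Qed.

Lemma iter_integral_ge0 k (f : W -> \bar R) z :
  (forall z, 0 <= f z) -> 0 <= iter_integral P k f z.
Proof.
move=> f0; elim: k z => [|k IH] z //=.
by apply: integral_ge0 => w _; exact: IH.
Qed.

Lemma iter_integral_upd k m (f : W -> \bar R) w z : (k <= m)%N ->
  iter_integral P k f (upd m w z) = iter_integral P k (f \o upd m w) z.
Proof.
elim: k z => [//|k IH] z km /=.
apply: eq_integral => v _; rewrite -/(upd k v (upd m w z)) -/(upd k v z).
rewrite updC; last by rewrite neq_ltn km.
by rewrite IH // ltnW.
Qed.

Lemma measurable_iter_integral k (f : W -> \bar R) :
  (forall z, 0 <= f z) -> measurable_fun setT f ->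
  measurable_fun setT (iter_integral P k f : W -> \bar R).
Proof.
move=> f0 mf; elim: k => [//|k IH] /=.
apply: (measurable_fun_fubini_tonelli_G
  (fun p : Z * W => iter_integral P k f (upd k p.1 p.2))).
- exact: (measurableT_comp IH (measurable_upd_pair k)).
- by move=> x; exact: iter_integral_ge0.
Qed.

Lemma measurable_iter_upd k m (f : W -> \bar R) z :
  (forall z, 0 <= f z) -> measurable_fun setT f ->
  measurable_fun setT (fun w => iter_integral P k f (upd m w z)).
Proof.
move=> f0 mf.
exact: (measurableT_comp (measurable_iter_integral k f0 mf) (measurable_upd m z)).
Qed.

(* The law of the sequence obtained from [z0] by resampling independently the
   coordinates below [k]. *)
Fixpoint resample (z0 : W) (k : nat) : probability W R :=
  match k with
  | 0 => \d_z0
  | k'.+1 => distribution (P \x resample z0 k') (upd_pair k')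
  end.

Lemma iter_integral_resample k (f : W -> \bar R) z :
  (forall z, 0 <= f z) -> measurable_fun setT f ->
  iter_integral P k f z = \int[resample z k]_v f v.
Proof.
elim: k f => [|k IH] f f0 mf.
  by rewrite /= integral_dirac // diracT mul1e.
rewrite [RHS]ge0_integral_distribution//.
rewrite fubini_tonelli1; last first.
- by move=> x; exact: f0.
- exact: (measurableT_comp mf (measurable_upd_pair k)).
apply: eq_integral => w _.
transitivity (iter_integral P k f (upd k w z)); first by [].
rewrite (iter_integral_upd (m := k) f w z (leqnn k)) IH//.
  by move=> v; exact: f0.
exact: (measurableT_comp mf (measurable_updr k w)).
Qed.

Lemma iter_integral_pull k (c f : W -> \bar R) z :
  (forall j w z, (j < k)%N -> c (upd j w z) = c z) ->
  (forall z, 0 <= c z) -> (forall z, 0 <= f z) -> measurable_fun setT f ->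
  iter_integral P k (fun z => c z * f z) z = c z * iter_integral P k f z.
Proof.
move=> cu c0 f0 mf; elim: k z cu => [//|k IH] z cu /=.
rewrite -ge0_integralZl//.
- apply: eq_integral => w _; rewrite -/(upd k w z).
  by rewrite IH ?cu// => j v y jk; apply: cu; exact: ltnW.
- exact: measurable_iter_upd.
- by move=> w _; exact: iter_integral_ge0.
Qed.

Lemma iter_integral_le_outer m K (f : W -> \bar R) (c : \bar R) z :
  (forall z, 0 <= f z) -> measurable_fun setT f -> 0 <= c ->
  (forall z, iter_integral P m f z <= c) -> iter_integral P (m + K) f z <= c.
Proof.
move=> f0 mf c0 H; elim: K z => [|K IH] z; first by rewrite addn0.
rewrite addnS /=.
have -> : c = \int[P]_w cst c w by rewrite integral_cst//= probability_setT mule1.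
apply: ge0_le_integral => //.
- by move=> w _; exact: iter_integral_ge0.
- exact: measurable_iter_upd.
Qed.

(** Source of the lower bound for high moments: the outer coordinates are the reference points, and
    confining them to a box costs a factor that does not depend on [f]. *)
Lemma iter_integral_ge_outer m K (f : W -> \bar R) (c : \bar R) (B : nat -> set Z) z :
  (forall z, 0 <= f z) -> measurable_fun setT f -> 0 <= c ->
  (forall k, measurable (B k)) ->
  (forall z, (forall k, (k < K)%N -> B k (z (m + k)%N)) -> c <= iter_integral P m f z) ->
  c * \prod_(0 <= k < K) P (B k) <= iter_integral P (m + K) f z.
Proof.
move=> f0 mf c0 mB H.
(* Integration proceeds from the inside outwards: once [k] outer coordinates are integrated, those
   of index at least [k] are still fixed in [y] and must already lie in their sets. *)
suff: forall k y, (k <= K)%N -> (forall j, (k <= j < K)%N -> B j (y (m + j)%N)) ->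
    c * \prod_(0 <= j < k) P (B j) <= iter_integral P (m + k) f y.
  by apply => // j /andP[]; rewrite leqNgt => /negbTE ->.
elim=> [|k IH] y kK Hy.
  rewrite big_nil mule1 addn0; apply: H => j jK.
  by apply: Hy; rewrite jK.
rewrite addnS /= big_nat_recr//= muleA.
set C := c * _.
have C0 : 0 <= C by rewrite mule_ge0// prode_ge0.
have -> : C * P (B k) = \int[P]_w (C * (\1_(B k) w)%:E).
  rewrite ge0_integralZl// ?integral_indic ?setIT//.
  exact/measurable_EFinP/measurable_indic.
apply: ge0_le_integral => //.
- by move=> w _; rewrite mule_ge0// lee_fin.
- apply: emeasurable_funM => //; exact/measurable_EFinP/measurable_indic.
- exact: measurable_iter_upd.
- move=> w _; rewrite -/(upd (m + k) w y).
  have [Bw|Bw] := pselect (B k w); last first.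
    rewrite indicE memNset// mule0; exact: iter_integral_ge0.
  rewrite indicE mem_set// mule1; apply: IH; first exact: ltnW.
  move=> j /andP[kj jK]; rewrite /upd eqn_add2l.
  case: eqP => [->//|/eqP jk]; apply: Hy.
  by rewrite jK ltn_neqAle eq_sym jk kj.
Qed.
End iterated_integral.

Section phi_integral.
Context {R : realType} {d : measure_display} {Z : measurableType d}.
Context {d' : measure_display} {A : measurableType d'}.
Variables P P' : probability Z R.
Local Open Scope ereal_scope.

(** [resample] turns [nfold_prod] into an honest law, so agreement on measurable sets of arrays
    extends to integrals of nonnegative functions of the array. *)
Lemma eq_iter_integral_comp n (D : ('I_n -> Z) -> A)
    (mD : measurable_fun setT (fun z : cylinderT nat Z => D (fun i => z i)))
    (Psi : A -> \bar R) :
  (forall B, measurable B -> nfold_prod P n (D @^-1` B) = nfold_prod P' n (D @^-1` B)) ->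
  (forall x, 0 <= Psi x) -> measurable_fun setT Psi ->
  iter_integral P n (fun z => Psi (D (fun i => z i))) (fun=> point) =
  iter_integral P' n (fun z => Psi (D (fun i => z i))) (fun=> point).
Proof.
move=> PP' Psi0 mPsi.
pose DW (z : cylinderT nat Z) := D (fun i => z i).
have mDPsi : measurable_fun setT (fun z : cylinderT nat Z => Psi (DW z)).
  exact: measurableT_comp mPsi mD.
have lawE (Q : probability Z R) B : measurable B ->
    pushforward (resample Q (fun=> point) n) DW B = nfold_prod Q n (D @^-1` B).
  move=> mB.
  have mDB : measurable (DW @^-1` B).
    by rewrite -[X in measurable X]setTI; exact: mD.
  transitivity (iter_integral Q n (fun z => (\1_(DW @^-1` B) z)%:E) (fun=> point)).
    rewrite iter_integral_resample.
    - by rewrite integral_indic ?setIT.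
    - by move=> z; rewrite lee_fin.
    - exact/measurable_EFinP/measurable_indic.
  by [].
rewrite !iter_integral_resample//.
have key (Q : probability Z R) : \int[resample Q (fun=> point) n]_v Psi (DW v) =
    \int[pushforward (resample Q (fun=> point) n) DW]_x Psi x.
  by rewrite ge0_integral_pushforward.
rewrite [LHS]key [RHS]key; apply: eq_measure_integral => B mB _.
by rewrite [LHS]lawE// [RHS]lawE// PP'.
Qed.
End phi_integral.

(** * Test functions and products of variances *)

Section unit_interval_integral.
Context {R : realType} {d : measure_display} {Z : measurableType d}.
Variable P : probability Z R.

Lemma integrable_unit (f : Z -> R) : measurable_fun setT f ->
  (forall z, 0 <= f z <= 1) -> P.-integrable setT (EFin \o f).
Proof.
move=> mf f01; apply: (@le_integrable _ _ _ P _ measurableT _ (EFin \o cst 1)).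
- exact/measurable_EFinP.
- move=> z _ /=; rewrite lee_fin normr1; have /andP[f0 f1] := f01 z.
  by rewrite ger0_norm.
- exact: finite_measure_integrable_cst.
Qed.

Lemma integral_affine (f : Z -> R) (a b : R) : measurable_fun setT f ->
  (forall z, 0 <= f z <= 1) ->
  (\int[P]_z (a + b * f z)%:E = (a + b * \int[P]_z f z)%:E)%E.
Proof.
move=> mf f01; have fi := integrable_unit mf f01.
have ai : P.-integrable setT (EFin \o cst a) by exact: finite_measure_integrable_cst.
have bfi : P.-integrable setT (EFin \o (fun z => b * f z)).
  by apply: eq_integrable (integrableZl _ b fi).
rewrite (integralD _ ai bfi)//= integral_cst//= probability_setT mule1.
rewrite EFinD EFinM; congr (_ + _)%E.
under eq_integral do rewrite EFinM.
rewrite integralZl//; congr (_ * _)%E.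
by rewrite /Rintegral fineK//; exact: integrable_fin_num.
Qed.

Lemma integral_unitE (f : Z -> R) : measurable_fun setT f ->
  (forall z, 0 <= f z <= 1) -> (\int[P]_z (f z)%:E = (\int[P]_z f z)%:E)%E.
Proof.
move=> mf f01; rewrite /Rintegral fineK//.
by apply: integrable_fin_num => //; exact: integrable_unit.
Qed.

Lemma Rintegral_unit (f : Z -> R) : measurable_fun setT f ->
  (forall z, 0 <= f z <= 1) -> 0 <= \int[P]_z f z <= 1.
Proof.
move=> mf f01; rewrite -!lee_fin -integral_unitE//; apply/andP; split.
  by apply: integral_ge0 => z _; rewrite lee_fin; have /andP[] := f01 z.
have <- : (\int[P]_z (cst 1%E z) = 1)%E by rewrite integral_cst//= probability_setT mule1.
apply: ge0_le_integral => //.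
- by move=> z _; rewrite lee_fin; have /andP[] := f01 z.
- exact/measurable_EFinP.
- by move=> z _; rewrite lee_fin; have /andP[] := f01 z.
Qed.

Lemma Rintegral_dist (f g : Z -> R) (c : R) :
  measurable_fun setT f -> (forall z, 0 <= f z <= 1) ->
  measurable_fun setT g -> (forall z, 0 <= g z <= 1) ->
  (forall z, `|f z - g z| <= c) -> `|\int[P]_z f z - \int[P]_z g z| <= c.
Proof.
move=> mf f01 mg g01 fg.
suff H (f1 f2 : Z -> R) : measurable_fun setT f1 -> (forall z, 0 <= f1 z <= 1) ->
    measurable_fun setT f2 -> (forall z, 0 <= f2 z <= 1) ->
    (forall z, f1 z <= c + f2 z) -> \int[P]_z f1 z <= c + \int[P]_z f2 z.
  rewrite ler_distl; apply/andP; split.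
  - rewrite lerBlDl; apply: H => // z.
    by have := fg z; rewrite ler_distl => /andP[]; lra.
  - rewrite addrC; apply: H => // z.
    by have := fg z; rewrite ler_distl => /andP[]; lra.
move=> m1 b1 m2 b2 b12.
have := integral_affine c 1 m2 b2; rewrite mul1r => eq2.
rewrite -lee_fin -eq2 -integral_unitE//.
apply: ge0_le_integral => //.
- by move=> z _; rewrite lee_fin; have /andP[] := b1 z.
- exact/measurable_EFinP.
- apply/measurable_EFinP; apply: measurable_funD => //.
  exact: measurable_funM.
- by move=> z _; rewrite mul1r lee_fin.
Qed.
End unit_interval_integral.

Section test_functions.
Context {R : realType}.

(* An element [(c, a, l, h)] stands for the factor [h (d_c (T^a z, w_l))]. *)
Definition test := seq (bool * nat * nat * (R -> R)).

(** The bounds keep products of factors in [[0, 1]]; the Lipschitz condition passes to means as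
    functions of the reference points. *)
Definition unit_lipschitz (h : R -> R) : Prop :=
  [/\ measurable_fun setT h, (forall t, 0 <= h t <= 1) &
      exists2 L : R, 0 <= L & forall s t, `|h s - h t| <= L * `|s - t|].

Definition good (phi : test) : Prop := forall e, List.In e phi -> unit_lipschitz e.2.

Definition test_val (phi : test) (E : bool -> nat -> nat -> R) : R :=
  \prod_(e <- phi) e.2 (E e.1.1.1 e.1.1.2 e.1.2).

Lemma good_cons e phi : good (e :: phi) -> unit_lipschitz e.2 /\ good phi.
Proof. by move=> H; split=> [|x xphi]; apply: H; [left|right]. Qed.

Lemma test_val01 phi E : good phi -> 0 <= test_val phi E <= 1.
Proof.
elim: phi => [|e phi IH]; first by rewrite /test_val big_nil ler01 lexx.
move=> /good_cons[[_ h01 _] /IH /andP[]]; rewrite /test_val big_cons => t0 t1.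
have /andP[h0 h1] := h01 (E e.1.1.1 e.1.1.2 e.1.2).
by rewrite mulr_ge0//= mulr_ile1.
Qed.

Lemma test_val_ext phi E E' :
  (forall e, List.In e phi -> E e.1.1.1 e.1.1.2 e.1.2 = E' e.1.1.1 e.1.1.2 e.1.2) ->
  test_val phi E = test_val phi E'.
Proof.
rewrite /test_val; elim: phi => [|e phi IH] H; first by rewrite !big_nil.
rewrite !big_cons IH ?H//; first by left.
by move=> x xphi; apply: H; right.
Qed.

Lemma measurable_test_val {d} {O : measurableType d} phi (E : O -> bool -> nat -> nat -> R) :
  good phi -> (forall c a l, measurable_fun setT (fun o => E o c a l)) ->
  measurable_fun setT (fun o => test_val phi (E o)).
Proof.
move=> gphi mE; elim: phi gphi => [|e phi IH].
  by move=> _; rewrite /test_val; under eq_fun do rewrite big_nil; exact: measurable_cst.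
move=> /good_cons[[mh _ _] /IH {}IH]; rewrite /test_val.
under eq_fun do rewrite big_cons.
apply: measurable_funM => //.
exact: (measurableT_comp mh (mE _ _ _)).
Qed.

Lemma test_val_lipschitz phi : good phi -> exists2 C : R, 0 <= C &
  forall E E' r,
    (forall e, List.In e phi ->
       `|E e.1.1.1 e.1.1.2 e.1.2 - E' e.1.1.1 e.1.1.2 e.1.2| <= r) ->
    `|test_val phi E - test_val phi E'| <= C * r.
Proof.
elim: phi => [|e phi IH].
  by exists 0 => // E E' r _; rewrite /test_val !big_nil subrr normr0 mul0r.
move=> /good_cons[[_ h01 [L L0 hL]] gphi]; have [C C0 HC] := IH gphi.
exists (L + C) => [|E E' r Er]; first exact: addr_ge0.
have := HC E E' r (fun x xphi => Er x (or_intror xphi)).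
have := Er e (or_introl erefl).
have := test_val01 E gphi; have := test_val01 E' gphi.
rewrite /test_val !big_cons.
set x := E _ _ _; set x' := E' _ _ _.
set p := \prod_(j <- phi) j.2 (E _ _ _).
set p' := \prod_(j <- phi) j.2 (E' _ _ _).
move=> /andP[p'0 p'1] /andP[p0 p1] xr pr.
have -> : e.2 x * p - e.2 x' * p' = (e.2 x - e.2 x') * p + e.2 x' * (p - p').
  by rewrite mulrBl mulrBr addrA subrK.
rewrite [leRHS]mulrDl; apply: le_trans (ler_normD _ _) _; apply: lerD.
- rewrite normrM (ger0_norm p0); apply: le_trans (ler_piMr _ p1) _ => //.
  apply: le_trans (hL _ _) _; exact: ler_wpM2l.
- have /andP[h0 h1] := h01 x'; rewrite normrM (ger0_norm h0).
  by apply: le_trans pr; rewrite ler_piMl.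
Qed.
End test_functions.
Arguments test : clear implicits.

Section variance_product.
Context {R : realType} {d : measure_display} {Z : measurableType d}.
Variables (dd : bool -> Z -> Z -> R) (TS : Z -> Z).
Hypothesis mdd : forall c, measurable_fun setT (fun p : Z * Z => dd c p.1 p.2).
Hypothesis mTS : measurable_fun setT TS.

Let arrays := bool -> nat -> nat -> nat -> nat -> R.

Definition centred := seq (test R * R).

Definition good_centred (cs : centred) : Prop :=
  forall c, List.In c cs -> good c.1 /\ 0 <= c.2 <= 1.

(** Independence of the points [k] and [k.+1] turns the product of deviations into the square of the
    mean deviation, whereas squaring one deviation would add a variance. Reference points occur with
    exponent [0], that is, without iteration. *)
Definition var_factor (c : test R * R) (M k : nat) (E : arrays) : R :=
  1 - (test_val c.1 (fun x a l => E x k (M + l)%N a 0%N) - c.2)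
      * (test_val c.1 (fun x a l => E x k.+1 (M + l)%N a 0%N) - c.2).

(* Each element of [cs] uses two fresh coordinates below [M], while the
   coordinates [M + l] play the role of the reference points. *)
Fixpoint var_prod (cs : centred) (M : nat) (E : arrays) : R :=
  match cs with
  | [::] => 1
  | c :: cs' => var_factor c M (size cs').*2 E * var_prod cs' M E
  end.

Lemma var_factor_ge0 c M k E : good c.1 -> 0 <= c.2 <= 1 -> 0 <= var_factor c M k E.
Proof.
move=> gc /andP[c0 c1]; rewrite /var_factor.
have /andP[x0 x1] := test_val01 (fun x a l => E x k (M + l)%N a 0%N) gc.
have /andP[y0 y1] := test_val01 (fun x a l => E x k.+1 (M + l)%N a 0%N) gc.
move: (test_val _ _) (test_val _ _) x0 x1 y0 y1 => x y x0 x1 y0 y1; nra.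
Qed.

Lemma good_centred_cons c cs : good_centred (c :: cs) ->
  [/\ good c.1, 0 <= c.2 <= 1 & good_centred cs].
Proof.
move=> H; have [] := H c (or_introl erefl); split=> //.
by move=> x xcs; apply: H; right.
Qed.

Lemma var_prod_ge0 cs M E : good_centred cs -> 0 <= var_prod cs M E.
Proof.
elim: cs => [|c cs IH] /=; first by rewrite ler01.
by move=> /good_centred_cons[gc c01 /IH cs0]; rewrite mulr_ge0// var_factor_ge0.
Qed.

Lemma measurable_var_factor {d'} {O : measurableType d'} c M k (E : O -> arrays) :
  good c.1 -> (forall x i j a b, measurable_fun setT (fun o => E o x i j a b)) ->
  measurable_fun setT (fun o => var_factor c M k (E o)).
Proof.
move=> gc mE; rewrite /var_factor; apply: measurable_funB => //.
apply: measurable_funM; apply: measurable_funB => //.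
- exact: (measurable_test_val (E := fun o x a l => E o x k (M + l)%N a 0%N)).
- exact: (measurable_test_val (E := fun o x a l => E o x k.+1 (M + l)%N a 0%N)).
Qed.

Lemma measurable_var_prod {d'} {O : measurableType d'} cs M (E : O -> arrays) :
  good_centred cs -> (forall x i j a b, measurable_fun setT (fun o => E o x i j a b)) ->
  measurable_fun setT (fun o => var_prod cs M (E o)).
Proof.
move=> gcs mE; elim: cs gcs => [|c cs IH] /=; first by move=> _; exact: measurable_cst.
move=> /good_centred_cons[gc _ /IH mcs]; apply: measurable_funM => //.
exact: measurable_var_factor.
Qed.

Lemma var_prod_ext cs M N m E E' :
  (forall c, List.In c cs -> forall e, List.In e c.1 -> (M + e.1.2 < N)%N /\ (e.1.1.2 < m)%N) ->
  ((size cs).*2 <= N)%N -> (0 < m)%N ->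
  (forall x i j a b, (i < N)%N -> (j < N)%N -> (a < m)%N -> (b < m)%N ->
     E x i j a b = E' x i j a b) ->
  var_prod cs M E = var_prod cs M E'.
Proof.
move=> + + m0 EE'; elim: cs => [//|c cs IH] /= Hcs; rewrite doubleS => sN.
rewrite IH//; last first.
- by rewrite (leq_trans _ sN)// -addn2 leq_addr.
- by move=> x xcs; apply: Hcs; right.
congr (_ * _); rewrite /var_factor.
congr (1 - (_ - _) * (_ - _)); apply: test_val_ext => e ec;
  have [lN am] := Hcs c (or_introl erefl) e ec; apply: EE' => //.
exact: ltn_trans (ltnSn _) sN.
Qed.

Definition array_of (z : nat -> Z) : arrays :=
  fun c i j a b => dd c (iter a TS (z i)) (iter b TS (z j)).

Lemma measurable_iterTS a : measurable_fun setT (iter a TS).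
Proof.
elim: a => [|a IH]; first exact: measurable_id.
exact: (measurableT_comp mTS IH).
Qed.

Lemma measurable_dd {d'} {O : measurableType d'} c (f g : O -> Z) :
  measurable_fun setT f -> measurable_fun setT g ->
  measurable_fun setT (fun o => dd c (f o) (g o)).
Proof.
by move=> mf mg; exact: (measurableT_comp (mdd c) (measurable_fun_pair mf mg)).
Qed.

Lemma measurable_array_of x i j a b :
  measurable_fun setT (fun z : cylinderT nat Z => array_of z x i j a b).
Proof.
by apply: measurable_dd;
  exact: (measurableT_comp (measurable_iterTS _) (measurable_coord _)).
Qed.

Definition mean (P : probability Z R) (phi : test R) (u : nat -> Z) : R :=
  \int[P]_z test_val phi (fun c a l => dd c (iter a TS z) (u l)).

Lemma measurable_test_dist phi (u : nat -> Z) : good phi ->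
  measurable_fun setT (fun z => test_val phi (fun c a l => dd c (iter a TS z) (u l))).
Proof.
move=> gphi.
apply: (measurable_test_val (E := fun z c a l => dd c (iter a TS z) (u l))) => // c a l.
apply: measurable_dd; [exact: measurable_iterTS|exact: measurable_cst].
Qed.

Lemma mean01 (P : probability Z R) phi u : good phi -> 0 <= mean P phi u <= 1.
Proof.
move=> gphi; apply: Rintegral_unit; first exact: measurable_test_dist.
by move=> z; exact: test_val01.
Qed.

Lemma integral_var_factor (P : probability Z R) (c : test R * R) (u : nat -> Z) : good c.1 ->
  (\int[P]_w \int[P]_v
     (1 - (test_val c.1 (fun x a l => dd x (iter a TS v) (u l)) - c.2)
        * (test_val c.1 (fun x a l => dd x (iter a TS w) (u l)) - c.2))%:E
   = (1 - (mean P c.1 u - c.2) ^+ 2)%:E)%E.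
Proof.
move=> gc; pose H z := test_val c.1 (fun x a l => dd x (iter a TS z) (u l)).
have mH : measurable_fun setT H by exact: measurable_test_dist.
have H01 z : 0 <= H z <= 1 by exact: test_val01.
set g := mean P c.1 u; have gE : \int[P]_z H z = g by [].
(* The integrand is affine in [H v] and, after the inner integration, affine in [H w]: each integral
   only replaces a value of [H] by its mean [g]. *)
under eq_integral => w _.
  under eq_integral => v _.
    rewrite (_ : 1 - _ = (1 + c.2 * (H w - c.2)) + (c.2 - H w) * H v); last by rewrite /H; ring.
    over.
  rewrite integral_affine// gE.
  rewrite (_ : _ + _ * g = (1 + (g - c.2) * c.2) + (c.2 - g) * H w); last by ring.
  over.
by rewrite integral_affine// gE; congr (_%:E); ring.
Qed.

(** Given the reference points, the factors use disjoint pairs of independent coordinates, so the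
    integral factorises. The bound by [M] keeps the integrated coordinates apart from the reference
    ones. *)
Lemma iter_integral_var_prod (P : probability Z R) cs M z : good_centred cs -> ((size cs).*2 <= M)%N ->
  iter_integral P (size cs).*2 (fun z => (var_prod cs M (array_of z))%:E) z =
  (\prod_(c <- cs) (1 - (mean P c.1 (fun l => z (M + l)%N) - c.2) ^+ 2))%:E.
Proof.
elim: cs z => [|c cs IH] z; first by rewrite big_nil.
move=> /good_centred_cons[gc c01 gcs] /=; rewrite doubleS => sM.
set k := (size cs).*2; rewrite big_cons mulrC EFinM.
have kM : (k <= M)%N by rewrite (leq_trans _ sM)// -addn2 leq_addr.
rewrite -(integral_var_factor P (fun l => z (M + l)%N) gc).
set C := \prod_(_ <- _) _.
have C0 : 0 <= C.
  rewrite /C -lee_fin -(IH z gcs kM); apply: iter_integral_ge0 => y.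
  by rewrite lee_fin var_prod_ge0.
pose H z' := test_val c.1 (fun x a l => dd x (iter a TS z') (z (M + l)%N)).
have mH : measurable_fun setT H by exact: measurable_test_dist.
have q0 v w : 0 <= 1 - (H v - c.2) * (H w - c.2).
  have /andP[x0 x1] : 0 <= H v <= 1 by exact: test_val01.
  have /andP[y0 y1] : 0 <= H w <= 1 by exact: test_val01.
  by move: c01 => /andP[]; nra.
have mq : measurable_fun setT (fun p : Z * Z => (1 - (H p.2 - c.2) * (H p.1 - c.2))%:E).
  apply/measurable_EFinP; apply: measurable_funB => //; apply: measurable_funM;
    apply: measurable_funB => //; apply: measurableT_comp => //.
rewrite -ge0_integralZl//; last first.
- by move=> w _; apply: integral_ge0 => v _; rewrite lee_fin; exact: q0.
- apply: (measurable_fun_fubini_tonelli_F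
    (fun p : Z * Z => (1 - (H p.2 - c.2) * (H p.1 - c.2))%:E)) => //.
  by move=> p; rewrite lee_fin; exact: q0.
apply: eq_integral => w _; rewrite -ge0_integralZl//; last first.
- by move=> v _; rewrite lee_fin; exact: q0.
- apply/measurable_EFinP; apply: measurable_funB => //; apply: measurable_funM => //.
  exact: measurable_funB.
apply: eq_integral => v _.
pose z' := upd k v (upd k.+1 w z).
have z'E l : z' (M + l)%N = z (M + l)%N.
  by rewrite /z' /upd !ifN//; apply/negP => /eqP Ml; move: sM; rewrite -/k; lia.
transitivity (iter_integral P k (fun y => (var_factor c M k (array_of y))%:E
                                   * (var_prod cs M (array_of y))%:E)%E z').
  by [].
(* The head factor reads only the coordinates [k], [k.+1] and those from [M] on, so it leaves the
   [k] inner integrals. *)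
rewrite iter_integral_pull.
- rewrite (IH z' gcs kM) muleC; congr (_%:E * _%:E)%E.
    by rewrite /C; apply: eq_bigr => x _; congr (1 - (mean _ _ _ - _) ^+ 2); apply/funext.
  rewrite /var_factor; congr (1 - (_ - _) * (_ - _)); apply: test_val_ext => e _;
    by rewrite /array_of z'E /z' /upd ?eqxx// ifN ?eqxx// neq_ltn ltnSn orbT.
- move=> j y t jk; congr (_%:E); rewrite /var_factor.
  congr (1 - (_ - _) * (_ - _)); apply: test_val_ext => e _; rewrite /array_of /upd.
  + by rewrite !ifN//; lia.
  + by rewrite !ifN//; lia.
- by move=> y; rewrite lee_fin var_factor_ge0.
- by move=> y; rewrite lee_fin var_prod_ge0.
- apply/measurable_EFinP; apply: measurable_var_prod => //; exact: measurable_array_of.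
Qed.

(** [TS] acts on the integrated point and never on [u], so the mean is Lipschitz in the reference
    points although [TS] is merely measurable. *)
Lemma mean_lipschitz (P : probability Z R) phi : good phi -> exists2 C : R, 0 <= C & forall u u' r,
  (forall c z z' w, `|dd c w z - dd c w z'| <= dd c z z') ->
  (forall e, List.In e phi -> dd e.1.1.1 (u e.1.2) (u' e.1.2) <= r) ->
  `|mean P phi u - mean P phi u'| <= C * r.
Proof.
move=> gphi; have [C C0 HC] := test_val_lipschitz gphi; exists C => // u u' r dT ur.
apply: Rintegral_dist.
- exact: measurable_test_dist.
- by move=> z; exact: test_val01.
- exact: measurable_test_dist.
- by move=> z; exact: test_val01.
- move=> z; apply: HC => e ephi; exact: le_trans (dT _ _ _ _) (ur e ephi).
Qed.
End variance_product.
Arguments centred : clear implicits.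

(** * Matching sequences *)

Lemma geometric_gap {R : realType} (c A A' : R) :
  0 < c -> 0 <= A' -> A' < A -> exists N, A' ^+ N < c * A ^+ N.
Proof.
move=> c0 A'0 A'A; have A0 : 0 < A by exact: le_lt_trans A'A.
have q1 : `|A' / A| < 1.
  by rewrite ger0_norm ?divr_ge0 ?(ltW A0)// ltr_pdivrMr// mul1r.
have /cvgrPdist_lt /(_ _ c0) [N _ HN] := cvg_expr q1.
exists N; have := HN N (leqnn N); rewrite /= sub0r normrN ger0_norm; last first.
  by rewrite exprn_ge0// divr_ge0// ltW.
by rewrite expr_div_n ltr_pdivrMr// exprn_gt0.
Qed.

Lemma prod_le_factor {R : realType} {I : Type} (s : seq I) (f : I -> R) i :
  List.In i s -> (forall j, List.In j s -> 0 <= f j <= 1) -> \prod_(j <- s) f j <= f i.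
Proof.
have H (t : seq I) : (forall j, List.In j t -> 0 <= f j <= 1) -> 0 <= \prod_(j <- t) f j <= 1.
  elim: t => [|j t IH] f01; first by rewrite big_nil ler01 lexx.
  rewrite big_cons; have /andP[j0 j1] := f01 j (or_introl erefl).
  have /andP[t0 t1] := IH (fun x xt => f01 x (or_intror xt)).
  by rewrite mulr_ge0//= mulr_ile1.
elim: s => [//|j s IH] [->|is_] f01; rewrite big_cons.
- have /andP[_ s1] := H s (fun x xt => f01 x (or_intror xt)).
  have /andP[i0 _] := f01 i (or_introl erefl); exact: ler_piMr.
- have /andP[j0 j1] := f01 j (or_introl erefl).
  have := IH is_ (fun x xt => f01 x (or_intror xt)).
  have /andP[s0 _] := H s (fun x xt => f01 x (or_intror xt)).
  by apply: le_trans; rewrite ler_piMl.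
Qed.

(** Uniform form of the Weierstrass product inequality, by induction on the list. *)
Lemma prod_ge_sum {R : realType} {I : Type} (s : seq I) (x : I -> R) (eta : R) :
  (forall j, List.In j s -> 0 <= x j <= 1) -> (forall j, List.In j s -> x j <= eta) ->
  1 - (size s)%:R * eta <= \prod_(j <- s) (1 - x j) /\ \prod_(j <- s) (1 - x j) <= 1.
Proof.
elim: s => [|j s IH] x01 xe; first by rewrite big_nil mul0r subr0 lexx.
rewrite big_cons /= -natr1 mulrDl mul1r.
have /andP[j0 j1] := x01 j (or_introl erefl); have je := xe j (or_introl erefl).
have [s0 s1] := IH (fun y ys => x01 y (or_intror ys)) (fun y ys => xe y (or_intror ys)).
have p0 : 0 <= \prod_(j <- s) (1 - x j).
  elim: s x01 {IH xe s0 s1} => [|k s IH] x01; first by rewrite big_nil ler01.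
  rewrite big_cons mulr_ge0//.
    by have /andP[_] := x01 k (or_intror (or_introl erefl)); rewrite subr_ge0.
  by apply: IH => y [<-|ys]; apply: x01; [left|right; right].
by move: (\prod_(_ <- _) _) s0 s1 p0 => p s0 s1 p0; split; nra.
Qed.

(** * Approximating means under one measure by means under the other *)

Section approximation.
Context {R : realType} {d : measure_display} {Z : measurableType d}.
Variables (dd : bool -> Z -> Z -> R) (TS : Z -> Z).
Hypothesis ddxx : forall c z, dd c z z = 0.
Hypothesis ddC : forall c z z', dd c z z' = dd c z' z.
Hypothesis ddT : forall c x y z, dd c x z <= dd c x y + dd c y z.
Hypothesis mdd : forall c, measurable_fun setT (fun p : Z * Z => dd c p.1 p.2).
Hypothesis mTS : measurable_fun setT TS.

Definition darr n m (z : 'I_n -> Z) : cylinderT (arr_index n m) R :=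
  fun k => let: (c, i, j, a, b) := k in dd c (iter a TS (z i)) (iter b TS (z j)).

Definition nearby (z : Z) (r : R) : set Z := [set z' | forall c, dd c z z' < r].

Lemma dd_ge0 c z z' : 0 <= dd c z z'.
Proof. by have := ddT c z z' z; rewrite ddxx (ddC c z' z); lra. Qed.

Lemma dd_lip c z z' w : `|dd c w z - dd c w z'| <= dd c z z'.
Proof.
have := ddT c w z z'; have := ddT c w z' z; rewrite (ddC c z' z) ler_distl => *.
by apply/andP; split; lra.
Qed.

Lemma measurable_nearby z r : measurable (nearby z r).
Proof.
have -> : nearby z r = [set z' | dd false z z' < r] `&` [set z' | dd true z z' < r].
  by apply/seteqP; split=> [z' H|z' [H1 H2] []]//; split; exact: H.
have mf c : measurable [set z' | dd c z z' < r].
  have m : measurable_fun setT (dd c z) by exact: measurable_dd.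
  rewrite (_ : [set _ | _] = setT `&` (dd c z) @^-1` `]-oo, r[); first exact: m.
  by rewrite setTI; apply/seteqP; split => z' /=; rewrite in_itv.
exact: measurableI.
Qed.

Variables P P' : probability Z R.
Hypothesis PhiE : forall n m, (0 < n)%N -> (0 < m)%N ->
  forall B, measurable B ->
    nfold_prod P n (@darr n m @^-1` B) = nfold_prod P' n (@darr n m @^-1` B).

Lemma test_index_bound (cs : centred R) : exists K m, forall c, List.In c cs ->
  forall e, List.In e c.1 -> (e.1.2 < K)%N /\ (e.1.1.2 < m)%N.
Proof.
have H1 (phi : test R) : exists K m, forall e, List.In e phi -> (e.1.2 < K)%N /\ (e.1.1.2 < m)%N.
  elim: phi => [|e phi [K [m IH]]]; first by exists 0%N, 0%N.
  exists (maxn e.1.2.+1 K), (maxn e.1.1.2.+1 m) => x [<-|/IH []]; first by lia.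
  by lia.
elim: cs => [|c cs [K [m IH]]]; first by exists 0%N, 0%N.
have [K' [m' H']] := H1 c.1.
exists (maxn K' K), (maxn m' m) => x [<-|xcs] e ex; first by have := H' e ex; lia.
by have := IH x xcs e ex; lia.
Qed.

Lemma eq_iter_var_prod cs M K : good_centred cs -> ((size cs).*2 <= M)%N ->
  (forall c, List.In c cs -> forall e, List.In e c.1 -> (e.1.2 < K.+1)%N) ->
  iter_integral P (M + K.+1) (fun z => (var_prod cs M (array_of dd TS z))%:E) (fun=> point) =
  iter_integral P' (M + K.+1) (fun z => (var_prod cs M (array_of dd TS z))%:E) (fun=> point).
Proof.
move=> gcs sM csK; have [K0 [m Hm]] := test_index_bound cs.
rewrite addnS; set n := (M + K)%N.
(* The integrand read off a finite array. The successors make the ordinals inhabited, as [inord]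
   requires, and meet the positivity conditions of [PhiE]. *)
pose Psi (x : cylinderT (arr_index n.+1 m.+1) R) :=
  var_prod cs M (fun c i j a b => x (c, inord i, inord j, inord a, inord b)).
have PsiE z : var_prod cs M (array_of dd TS z) = Psi (@darr n.+1 m.+1 (fun i : 'I_n.+1 => z i)).
  apply: (@var_prod_ext _ cs M n.+1 m.+1) => //.
  - move=> c ccs e ec; have [_ em] := Hm c ccs e ec; have eK := csK c ccs e ec.
    by split; rewrite /n ?ltnS ?leq_add2l /=; [exact: eK|exact: ltnW].
  - by rewrite (leq_trans sM)// -addnS leq_addr.
  - by move=> x i j a b iN jN am bm; rewrite /array_of /darr !inordK.
under eq_fun do rewrite PsiE.
apply: (@eq_iter_integral_comp _ _ _ _ _ P P' n.+1 (@darr n.+1 m.+1) _ (EFin \o Psi)).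
- apply: measurable_cylinderT => -[[[[c i] j] a] b].
  exact: (measurable_array_of mdd mTS c i j a b).
- exact: PhiE.
- by move=> x; rewrite lee_fin var_prod_ge0.
- apply/measurable_EFinP; apply: measurable_var_prod => // *.
  exact: measurable_coord.
Qed.

Lemma common_lipschitz (phis : seq (test R)) : (forall phi, List.In phi phis -> good phi) ->
  exists2 C : R, 0 <= C & forall phi, List.In phi phis -> forall u u' r, 0 <= r ->
    (forall e, List.In e phi -> dd e.1.1.1 (u e.1.2) (u' e.1.2) <= r) ->
    `|mean dd TS P phi u - mean dd TS P phi u'| <= C * r.
Proof.
elim: phis => [|phi phis IH] gphis; first by exists 0.
have [C C0 HC] := IH (fun x xs => gphis x (or_intror xs)).
have [C' C'0 HC'] := mean_lipschitz mdd mTS P (gphis phi (or_introl erefl)).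
exists (C + C'); first exact: addr_ge0.
move=> x [<-|xs] u u' r r0 ur.
- apply: le_trans (HC' u u' r dd_lip ur) _; rewrite ler_wpM2r//; lra.
- apply: le_trans (HC x xs u u' r r0 ur) _; rewrite ler_wpM2r//; lra.
Qed.

(* Otherwise the [N]-th moments of the product of the [1 - (mean - g)^2], which
   are determined by the array laws, would decay at different rates. *)
Lemma approximation (phis : seq (test R)) (w : nat -> Z) (eps : R) :
  (forall phi, List.In phi phis -> good phi) ->
  (forall l r, 0 < r -> (0 < P (nearby (w l) r))%E) -> 0 < eps ->
  exists u, forall phi, List.In phi phis ->
    `|mean dd TS P phi w - mean dd TS P' phi u| < eps.
Proof.
move=> gphis wP eps0; apply: contrapT => /forallNP noapprox.
have far u : exists2 phi, List.In phi phis &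
    eps <= `|mean dd TS P phi w - mean dd TS P' phi u|.
  have /existsNP[phi /not_implyP[phis_ /negP]] := noapprox u.
  by rewrite -leNgt; exists phi.
have m01 (Q : probability Z R) phi u : List.In phi phis -> 0 <= mean dd TS Q phi u <= 1.
  by move=> ?; apply: mean01 => //; exact: gphis.
have sq01 (Q : probability Z R) phi u : List.In phi phis ->
    0 <= (mean dd TS Q phi u - mean dd TS P phi w) ^+ 2 <= 1.
  move=> H; have /andP[a0 a1] := m01 Q phi u H; have /andP[b0 b1] := m01 P phi w H.
  by rewrite sqr_ge0/=; nra.
(* Means lie in [[0, 1]], so no deviation exceeds 1; this makes the rate [1 - eps ^+ 2]
   nonnegative. *)
have eps1 : eps <= 1.
  have [phi H] := far w; have /andP[a0 a1] := m01 P' phi w H.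
  by have /andP[b0 b1] := m01 P phi w H; move=> /le_trans; apply; rewrite ler_norml; lra.
pose cs : centred R := [seq (phi, mean dd TS P phi w) | phi <- phis].
pose F Q u := \prod_(phi <- phis) (1 - (mean dd TS Q phi u - mean dd TS P phi w) ^+ 2).
have F0 Q u : 0 <= F Q u.
  rewrite /F; elim: (phis) (sq01 Q) => [|phi s IH] sq; first by rewrite big_nil ler01.
  rewrite big_cons mulr_ge0//.
    by have /andP[_] := sq phi u (or_introl erefl); rewrite subr_ge0.
  by apply: IH => x v xs; apply: sq; right.
have Fup u : F P' u <= 1 - eps ^+ 2.
  have [phi phis_ e] := far u; apply: le_trans (prod_le_factor phis_ _) _.
    by move=> x /(sq01 P' _ u); lra.
  rewrite lerB// -[leRHS]real_normK ?num_real// distrC lerXn2r// nnegrE ?normr_ge0//; exact: ltW.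
(* Half of the gap [eps ^+ 2] is shared among the factors; the successor avoids division by zero.
   Since [eta <= 1], a deviation of at most [eta] has square at most [eta]. *)
pose eta := eps ^+ 2 / (2 * (size phis).+1%:R).
have eta0 : 0 < eta by rewrite divr_gt0// ?exprn_gt0// mulr_gt0.
have eta_size : (size phis)%:R * eta <= eps ^+ 2 / 2.
  have -> : eps ^+ 2 / 2 = (size phis).+1%:R * eta by rewrite /eta; field; rewrite nat1r.
  by rewrite ler_wpM2r ?ler_nat// ltW.
have eta1 : eta <= 1.
  rewrite /eta ler_pdivrMr ?mulr_gt0// mul1r.
  have : 1 <= (size phis).+1%:R :> R by rewrite ler1n.
  by nra.
have [C C0 HC] := common_lipschitz gphis.
(* Moving the reference points by [rho] moves each mean by at most [eta]; the summand 1 covers the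
   case [C = 0]. *)
pose rho := eta / (C + 1).
have rho0 : 0 < rho by rewrite divr_gt0// ltr_wpDl.
have Crho : C * rho <= eta.
  rewrite /rho mulrA ler_pdivrMr ?ltr_wpDl//; nra.
have [K [m Km]] := test_index_bound cs.
have inK phi : List.In phi phis -> forall e, List.In e phi -> (e.1.2 < K.+1)%N.
  move=> Hphi e ephi.
  have [] := Km (phi, mean dd TS P phi w) (List.in_map _ _ _ Hphi) e ephi; lia.
have Flow u : (forall k, (k < K.+1)%N -> nearby (w k) rho (u k)) -> 1 - eps ^+ 2 / 2 <= F P u.
  move=> uw.
  have [] := @prod_ge_sum R _ phis (fun phi => (mean dd TS P phi u - mean dd TS P phi w) ^+ 2) eta.
  - by move=> phi; exact: sq01.
  - move=> phi Hphi.
    have : `|mean dd TS P phi u - mean dd TS P phi w| <= eta.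
      apply: le_trans Crho; apply: HC => //; first exact: ltW.
      by move=> e ephi; rewrite ddC; apply/ltW/uw/(inK phi).
    rewrite ler_norml => /andP[]; nra.
  - by move=> H _; apply: le_trans H; lra.
(* Mass of the box of reference points around [w]. It is fixed before [N], so it cannot compensate
   an exponential gap between the two rates. *)
pose c := \prod_(0 <= k < K.+1) fine (P (nearby (w k) rho)).
have cE : (\prod_(0 <= k < K.+1) P (nearby (w k) rho) = c%:E)%E.
  rewrite /c -prodEFin; apply: eq_bigr => k _; rewrite fineK//.
  exact: fin_num_measure (measurable_nearby _ _).
have c0 : 0 < c.
  apply: prodr_gt0 => k _; rewrite fine_gt0// wP//=.
  by rewrite ltey_eq fin_num_measure//; exact: measurable_nearby.
have [N] := @geometric_gap R c (1 - eps ^+ 2 / 2) (1 - eps ^+ 2) c0 ltac:(nra) ltac:(nra).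
apply/negP; rewrite -leNgt.
(* Each copy of [cs] takes new fresh points but the same reference indices: integration yields the
   [N]-th power of [F], still with only [K.+1] reference points. *)
pose csN := flatten (nseq N cs); pose M := (size csN).*2.
have incs x : List.In x csN -> List.In x cs.
  have : forall k, List.In x (flatten (nseq k cs)) -> List.In x cs.
    by elim=> [//|k IH] /= /(List.in_app_or cs (flatten (nseq k cs)) x)[].
  by apply.
have gcsN : good_centred csN.
  move=> x /incs /List.in_map_iff[phi [<- Hphi]] /=.
  by split; [exact: gphis|exact: m01].
have prodE Q u :
    \prod_(x <- csN) (1 - (mean dd TS Q x.1 u - x.2) ^+ 2) = F Q u ^+ N.
  by rewrite /csN big_flatten big_nseq /cs big_map -/(F Q u) iter_mulr mulr1.
have mV : measurable_fun setT
    (fun z : cylinderT nat Z => (var_prod csN M (array_of dd TS z))%:E).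
  apply/measurable_EFinP; apply: measurable_var_prod => //.
  exact: measurable_array_of.
have V0 z : (0 <= (var_prod csN M (array_of dd TS z))%:E)%E.
  by rewrite lee_fin var_prod_ge0.
rewrite -lee_fin mulrC EFinM -cE.
apply: (@le_trans _ _ (iter_integral P (M + K.+1)
  (fun z => (var_prod csN M (array_of dd TS z))%:E) (fun=> point))).
  apply: iter_integral_ge_outer => //.
  - by rewrite lee_fin exprn_ge0//; nra.
  - by move=> k; exact: measurable_nearby.
  - move=> z zw; rewrite iter_integral_var_prod// prodE lee_fin lerXn2r ?nnegrE//; first by nra.
    exact: Flow.
rewrite eq_iter_var_prod//; last first.
  by move=> x /incs /List.in_map_iff[phi [<- Hphi]] e; exact: (inK phi).
apply: iter_integral_le_outer => //.
- by rewrite lee_fin exprn_ge0//; nra.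
- move=> z; rewrite iter_integral_var_prod// prodE lee_fin lerXn2r ?nnegrE//; nra.
Qed.

Hypothesis ultra_cvg : forall (A : Type) (U : set_system A), UltraFilter U ->
  forall g : A -> Z, exists p, forall r, 0 < r -> U (g @^-1` nearby p r).

(** By [approximation] the sets [B q], over finite lists of tests and positive tolerances, form a
    proper filter base; an ultrafilter refining it provides one limit sequence for all tests at
    once. *)
Lemma matching_sequence (w : nat -> Z) :
  (forall l r, 0 < r -> (0 < P (nearby (w l) r))%E) ->
  exists w', forall phi, good phi -> mean dd TS P phi w = mean dd TS P' phi w'.
Proof.
move=> wP.
pose D := [set q : seq (test R) * R | (forall phi, List.In phi q.1 -> good phi) /\ 0 < q.2].
pose B (q : seq (test R) * R) := [set u | forall phi, List.In phi q.1 ->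
    `|mean dd TS P phi w - mean dd TS P' phi u| < q.2].
have FB : ProperFilter (filter_from D B).
  apply: filter_from_proper.
    apply: filter_from_filter; first by exists ([::], 1).
    move=> [s1 e1] [s2 e2] [/= g1 e10] [/= g2 e20].
    exists (s1 ++ s2, Num.min e1 e2).
      split=> /=; last by rewrite lt_min e10.
      by move=> phi /(List.in_app_or s1 s2 phi)[]; [exact: g1|exact: g2].
    move=> u /= Hu; split=> phi Hphi /=.
    - have := Hu phi (List.in_or_app s1 s2 phi (or_introl Hphi)).
      by rewrite lt_min => /andP[].
    - have := Hu phi (List.in_or_app s1 s2 phi (or_intror Hphi)).
      by rewrite lt_min => /andP[].
  move=> [s e] [/= gs e0]; have [u Hu] := approximation gs wP e0.
  by exists u.
have [U [UU FU]] := ultraFilterLemma FB.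
have lim l : {p | forall r, 0 < r -> U ((fun u : nat -> Z => u l) @^-1` nearby p r)}.
  by apply: cid; exact: ultra_cvg.
exists (fun l => sval (lim l)) => phi gphi.
have [C C0 HC] := mean_lipschitz mdd mTS P' gphi.
apply/eqP; rewrite -subr_eq0 -normr_le0; apply/ler_addgt0Pl => e e0; rewrite addr0.
(* A test involves finitely many indices, so coordinatewise convergence along [U] is uniform on
   them. *)
have close (s : test R) r : 0 < r -> U [set u | forall e, List.In e s ->
    dd e.1.1.1 (u e.1.2) (sval (lim e.1.2)) <= r].
  move=> r0; elim: s => [|x s IH]; first by apply: filterS filterT => u _ y [].
  have := svalP (lim x.1.2) r r0; apply: filterS2 IH => u us ux y [<-|/us//].
  by rewrite ddC; exact/ltW/ux.
have [u [u1 u2]] : exists u, B ([:: phi], e / 2) u /\ (forall x, List.In x phi ->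
    dd x.1.1.1 (u x.1.2) (sval (lim x.1.2)) <= e / 2 / (C + 1)).
  apply: (@filter_ex _ U); apply: filterI.
  - apply: FU; exists ([:: phi], e / 2) => //; split=> /=; last by rewrite divr_gt0.
    by move=> x [<-|].
  - by apply: close; rewrite !divr_gt0// ltr_wpDl.
have := u1 phi (or_introl erefl); have := HC u (fun l => sval (lim l)) _ dd_lip u2.
have : C * (e / 2 / (C + 1)) <= e / 2.
  by rewrite mulrA ler_pdivrMr ?ltr_wpDl//; nra.
move=> h1 h2 /= h3; rewrite -(subrKA (mean dd TS P' phi u)).
apply: le_trans (ler_normD _ _) _; lra.
Qed.
End approximation.

(** * Laws of distance profiles *)

Section halflines.
Context {R : realType} {I : Type}.

(** A pi-system, closed under intersection by concatenation of lists, which generates the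
    sigma-algebra of [cylinderT]. *)
Definition halflines : set (set (cylinderT I R)) :=
  [set B | exists s : seq (I * R), B = [set e | forall p, List.In p s -> e p.1 <= p.2]].

Lemma measurable_halflines B : halflines B -> measurable (B : set (cylinderT I R)).
Proof.
move=> [s ->]; elim: s => [|p s IH].
  by rewrite (_ : [set _ | _] = setT) //; apply/seteqP; split => // e _ q [].
rewrite (_ : [set _ | _] = (fun e : cylinderT I R => e p.1) @^-1` `]-oo, p.2] `&`
    [set e | forall q, List.In q s -> e q.1 <= q.2]).
  apply: measurableI => //.
  by rewrite -[X in measurable X]setTI; exact: (measurable_coord p.1).
apply/seteqP; split => e /=.
- move=> H; split; first by rewrite in_itv/=; apply: H; left.
  by move=> q qs; apply: H; right.
- by rewrite in_itv /= => -[ep es] q [<-//|]; exact: es.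
Qed.

Lemma measurable_gen_halflines B :
  measurable (B : set (cylinderT I R)) -> <<s halflines >> B.
Proof.
apply: smallest_sub; first exact: smallest_sigma_algebra.
move=> _ [k [A [mA ->]]].
have mk : measurable_fun setT (fun e : g_sigma_algebraType halflines => e k).
  apply: (measurability _ (RGenOInfty.measurableE R)) => _ [_ [x ->] <-].
  rewrite setTI -[X in measurable X]setCK; apply: measurableC.
  apply: sub_sigma_algebra; exists [:: (k, x)]; apply/seteqP; split => e /=.
  - by rewrite in_itv /= andbT => /negP; rewrite -leNgt => ex p [<-|].
  - move=> H; rewrite in_itv /= andbT; apply/negP; rewrite -leNgt.
    by apply: (H (k, x)); left.
by have := mk measurableT A mA; rewrite setTI.
Qed.

Lemma cylinder_measure_unique (m1 m2 : probability (cylinderT I R) R) :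
  (forall B, halflines B -> m1 B = m2 B) ->
  forall B, measurable B -> m1 B = m2 B.
Proof.
move=> m12 B /measurable_gen_halflines.
apply: (@g_sigma_algebra_measure_unique _ R (cylinderT I R) halflines _ (fun=> setT)).
- exact: measurable_halflines.
- by move=> _; exists [::]; apply/seteqP; split => // e _ p [].
- by apply/seteqP; split=> // e _; exists 0%N.
- move=> _ _ [s ->] [t ->]; exists (s ++ t); apply/seteqP; split => e /=.
  + move=> [es et] p /(List.in_app_or s t p)[]; [exact: es|exact: et].
  + move=> H; split=> p ps; apply: H; apply: (List.in_or_app s t p); [left|right]; exact: ps.
- exact: m12.
- by move=> _; rewrite /= probability_setT ltry.
Qed.
End halflines.

Section step_functions.
Context {R : realType}.

(** Equal to 1 up to [r] and, for positive [n], to 0 from [r + 1/n] on. The limit is the indicator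
    of the closed half-line, and at each [t] it is attained after finitely many steps. *)
Definition ramp (n : nat) (r t : R) : R := Num.max 0 (Num.min 1 (1 - n%:R * (t - r))).

Lemma ramp_lipschitz n r : unit_lipschitz (ramp n r).
Proof.
split.
- apply: measurable_maxr => //; apply: measurable_minr => //.
  apply: measurable_funB => //; apply: measurable_funM => //; exact: measurable_funB.
- by move=> t; rewrite le_max lexx /= ge_max ler01 ge_min lexx.
- exists n%:R => // s t.
  have : 1 - n%:R * (s - r) <= 1 - n%:R * (t - r) + `|n%:R * (s - t)|.
    by have := ler_norm (- (n%:R * (s - t))); rewrite normrN; lra.
  have : 1 - n%:R * (t - r) <= 1 - n%:R * (s - r) + `|n%:R * (s - t)|.
    by have := ler_norm (n%:R * (s - t)); lra.
  have := normr_ge0 (n%:R * (s - t)); rewrite -[X in _ <= X * _](@normr_nat R) -normrM.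
  rewrite /ramp; move: (1 - _) (1 - _) `|_ * _| => a b c c0 ab ba.
  by rewrite ler_distl /Num.max /Num.min; case: ifP; case: ifP; case: ifP; case: ifP; lra.
Qed.

Lemma ramp_eventually r t : exists N, forall n, (N <= n)%N -> ramp n r t = (t <= r)%R%:R.
Proof.
have [tr|rt] := leP t r.
  exists 0%N => n _; rewrite /ramp min_l ?max_r ?ler01//.
  by rewrite lerBrDr gerDl mulr_ge0_le0// subr_le0.
have [N HN] : exists N : nat, 1 / (t - r) <= N%:R.
  by exists (Num.truncn (1 / (t - r))).+1; exact/ltW/truncnS_gt.
exists N => n Nn; rewrite /ramp max_l// ge_min subr_le0; apply/orP; right.
by rewrite -ler_pdivrMr ?subr_gt0//; apply: le_trans HN _; rewrite ler_nat.
Qed.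

Definition ramps (n : nat) (s : seq (bool * nat * nat * R)) : test R :=
  [seq (p.1, ramp n p.2) | p <- s].

Lemma good_ramps n s : good (ramps n s).
Proof. by move=> e /List.in_map_iff[p [<- _]]; exact: ramp_lipschitz. Qed.

Lemma ramps_eventually s (E : bool -> nat -> nat -> R) : exists N, forall n, (N <= n)%N ->
  test_val (ramps n s) E =
  \1_[set e : bool * nat * nat -> R | forall p, List.In p s -> e p.1 <= p.2]
    (fun i => E i.1.1 i.1.2 i.2).
Proof.
elim: s => [|p s [N HN]].
  exists 0%N => n _; rewrite /test_val big_nil indicE mem_set//.
have [M HM] := ramp_eventually p.2 (E p.1.1.1 p.1.1.2 p.1.2).
exists (maxn M N) => n; rewrite geq_max => /andP[Mn Nn].
rewrite /test_val /= big_cons /= HM// -/(test_val (ramps n s) E) HN// !indicE -natrM mulnb.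
congr (_%:R); congr nat_of_bool; apply/idP/idP.
- by move=> /andP[ep]; rewrite !inE => es q [<-//|]; exact: es.
- rewrite !inE => H; apply/andP; split; first by apply: (H p); left.
  by rewrite inE => q qs; apply: (H q); right.
Qed.
End step_functions.

Section profile_law.
Context {R : realType} {d : measure_display} {Z : measurableType d}.
Variables (dd : bool -> Z -> Z -> R) (TS : Z -> Z).
Hypothesis mdd : forall c, measurable_fun setT (fun p : Z * Z => dd c p.1 p.2).
Hypothesis mTS : measurable_fun setT TS.

Definition profile (w : nat -> Z) (z : Z) : cylinderT (bool * nat * nat) R :=
  fun i => dd i.1.1 (iter i.1.2 TS z) (w i.2).

Lemma measurable_profile w : measurable_fun setT (profile w).
Proof.
apply: measurable_cylinderT => i; apply: measurable_dd => //.
exact: measurable_iterTS.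
Qed.

Lemma mean_ramps_cvg (P : probability Z R) w s :
  (mean dd TS P (ramps n s) w)%:E @[n --> \oo] -->
  P (profile w @^-1` [set e | forall p, List.In p s -> e p.1 <= p.2]).
Proof.
set B := [set e | _].
have mB : measurable (profile w @^-1` B).
  rewrite -[X in measurable X]setTI; apply: measurable_profile => //.
  by apply: measurable_halflines; exists s.
have -> : P (profile w @^-1` B) = (\int[P]_z (\1_(profile w @^-1` B) z)%:E)%E.
  by rewrite integral_indic// setIT.
have -> : (fun n => (mean dd TS P (ramps n s) w)%:E) = (fun n => \int[P]_z
    (test_val (ramps n s) (fun c a l => dd c (iter a TS z) (w l)))%:E)%E.
  apply/funext => n; rewrite /mean integral_unitE//.
  - exact: (measurable_test_dist mdd mTS w (@good_ramps R n s)).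
  - by move=> z; exact: test_val01 (@good_ramps R n s).
apply: (@dominated_cvg _ _ _ P _ measurableT _ _ (cst 1%E)) => //.
- by move=> n; apply/measurable_EFinP; exact: (measurable_test_dist mdd mTS w (@good_ramps R n s)).
- move=> z _; have [N HN] := ramps_eventually s (fun c a l => dd c (iter a TS z) (w l)).
  apply: cvg_near_cst; exists N => // n Nn; rewrite HN//.
- exact: finite_measure_integrable_cst.
- move=> n z _; have /andP[t0 t1] := test_val01 (fun c a l => dd c (iter a TS z) (w l)) (@good_ramps R n s).
  by rewrite /= lee_fin ger0_norm.
Qed.

(** By dominated convergence the means of [ramps] tend to the probabilities of the sets in
    [halflines], and these determine the law. *)
Lemma profile_law (P P' : probability Z R) w w' :
  (forall phi, good phi -> mean dd TS P phi w = mean dd TS P' phi w') ->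
  forall B, measurable B -> P (profile w @^-1` B) = P' (profile w' @^-1` B).
Proof.
move=> PP'.
pose f v : {mfun Z >-> cylinderT (bool * nat * nat) R} := HB.pack (profile v)
  (isMeasurableFun.Build _ _ _ _ (profile v) (measurable_profile v)).
apply: (@cylinder_measure_unique R _ (distribution P (f w)) (distribution P' (f w'))).
move=> _ [s ->].
have H := @mean_ramps_cvg P w s.
have H' := @mean_ramps_cvg P' w' s.
rewrite -(_ : (fun n => (mean dd TS P (ramps n s) w)%:E) =
  (fun n => (mean dd TS P' (ramps n s) w')%:E)) in H'; last first.
  by apply/funext => n; rewrite (PP' _ (@good_ramps R n s)).
exact: (cvg_unique _ H H').
Qed.
End profile_law.

(** * Recovering points from their profiles *)

Lemma eq_of_dist_le {R : realType} (x y : R) :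
  (forall r : R, 0 < r -> `|x - y| <= r) -> x = y.
Proof.
move=> H; apply/eqP; rewrite -subr_eq0 -normr_le0.
by apply/ler_addgt0Pl => r r0; rewrite addr0; exact: H.
Qed.

Section radii.
Context {R : realType}.

Definition radn (n : nat) : R := n.+1%:R^-1.

Lemma radn_gt0 n : 0 < radn n.
Proof. by rewrite invr_gt0. Qed.

Lemma le_radn m n : (m <= n)%N -> radn n <= radn m.
Proof. by move=> mn; rewrite lef_pV2 ?posrE// ler_nat. Qed.

Lemma small_radn (r : R) : 0 < r -> exists n, radn n < r.
Proof. by move=> /ltr_add_invr[n]; rewrite add0r; exists n. Qed.
End radii.

Section almost_sure.
Context {R : realType} {d : measure_display} {T : measurableType d}.
Variable P : probability T R.

Lemma prob1_ae (A : set T) : measurable A -> P A = 1%E -> {ae P, forall x, A x}.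
Proof.
move=> mA A1; apply/negligibleP; first exact: measurableC.
by rewrite /= probability_setC// A1 subee.
Qed.

Lemma ae_prob1 (A : set T) : measurable A -> {ae P, forall x, A x} -> P A = 1%E.
Proof.
move=> mA /negligibleP H.
have A0 : P (~` A) = 0%E by apply: H; exact: measurableC.
by rewrite -[A]setCK probability_setC ?A0 ?sube0//; exact: measurableC.
Qed.

Lemma eq_measure_ae (A B : set T) : measurable A -> measurable B ->
  {ae P, forall x, A x <-> B x} -> P A = P B.
Proof.
suff H A' B' : measurable A' -> measurable B' -> {ae P, forall x, A' x <-> B' x} ->
    (P A' <= P B')%E.
  move=> mA mB AB; apply/eqP; rewrite eq_le !H//.
  by apply: filterS AB => x [].
move=> mA mB [N [mN N0 AN]]; rewrite -(measureU0 mB mN N0).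
apply: le_measure; rewrite ?inE//; first exact: measurableU.
move=> x A'x; have [Bx|Bx] := pselect (B' x); first by left.
by right; apply: AN => /= -[/(_ A'x)].
Qed.

Lemma ae_exists (A : T -> Prop) : {ae P, forall x, A x} -> exists x, A x.
Proof.
move=> [N [mN N0 AN]]; apply: contrapT => /forallNP noA.
have NT : N = setT by apply/seteqP; split => // x _; apply: AN; exact: noA.
by move: N0; rewrite NT /= probability_setT => /eqP; rewrite onee_eq0.
Qed.

Lemma ae_prod (A : T -> Prop) : {ae P, forall x, A x} ->
  {ae (P \x P)%E, forall p : T * T, A p.1 /\ A p.2}.
Proof.
move=> [N [mN N0 AN]].
apply: (@negligibleS _ _ _ _ ((N `*` setT) `|` (setT `*` N))).
  move=> [x y] /= /not_andP[] /AN; [by left|by right].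
apply: negligibleU; apply/negligibleP.
- exact: measurableX.
- by rewrite /= product_measure1E//= N0 mul0e.
- exact: measurableX.
- by rewrite /= product_measure1E//= N0 mule0.
Qed.

Lemma ae_forall_count {I : countType} (A : I -> T -> Prop) :
  (forall i, {ae P, forall x, A i x}) -> {ae P, forall x, forall i, A i x}.
Proof.
move=> HA.
have : {ae P, forall x, forall n : nat, if unpickle n is Some i then A i x else True}.
  apply: ae_foralln => n; case: (unpickle n) => [i|]; first exact: HA.
  by apply: filterS filterT.
by apply: filterS => x H i; have := H (pickle i); rewrite pickleK.
Qed.
End almost_sure.

Section measurable_comprehension.
Context {d : measure_display} {O : measurableType d}.

Lemma measurable_exists_nat (Q : nat -> O -> Prop) :
  (forall n, measurable [set o | Q n o]) -> measurable [set o | exists n, Q n o].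
Proof.
move=> mQ; rewrite (_ : [set _ | _] = \bigcup_n [set o | Q n o]).
  exact: bigcupT_measurable.
by apply/seteqP; split => o [n]; exists n.
Qed.

Lemma measurable_forall_nat (Q : nat -> O -> Prop) :
  (forall n, measurable [set o | Q n o]) -> measurable [set o | forall n, Q n o].
Proof.
move=> mQ; rewrite (_ : [set _ | _] = \bigcap_n [set o | Q n o]).
  exact: bigcapT_measurable.
by apply/seteqP; split => o H n; [move=> _; exact: H|exact: (H n Logic.I)].
Qed.

Lemma measurable_forall_bool (Q : bool -> O -> Prop) :
  (forall n, measurable [set o | Q n o]) -> measurable [set o | forall n, Q n o].
Proof.
move=> mQ; rewrite (_ : [set _ | _] = [set o | Q false o] `&` [set o | Q true o]).
  exact: measurableI.
by apply/seteqP; split => o; [split; exact: H|move=> [? ?] []].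
Qed.

Lemma measurable_lt_cst {R : realType} (f : O -> R) (r : R) :
  measurable_fun setT f -> measurable [set o | f o < r].
Proof.
move=> mf; rewrite (_ : [set _ | _] = setT `&` f @^-1` `]-oo, r[); first exact: mf.
by rewrite setTI; apply/seteqP; split => z' /=; rewrite in_itv.
Qed.

Lemma measurable_le_cst {R : realType} (f : O -> R) (r : R) :
  measurable_fun setT f -> measurable [set o | f o <= r].
Proof.
move=> mf; rewrite (_ : [set _ | _] = setT `&` f @^-1` `]-oo, r]); first exact: mf.
by rewrite setTI; apply/seteqP; split => z' /=; rewrite in_itv.
Qed.

Lemma measurable_eq_fun {R : realType} (f g : O -> R) :
  measurable_fun setT f -> measurable_fun setT g -> measurable [set o | f o = g o].
Proof.
move=> mf mg; have mt : measurable [set true] by [].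
have := measurable_fun_eqr mf mg measurableT mt.
by congr measurable; rewrite setTI; apply/seteqP; split => o /= /eqP.
Qed.
End measurable_comprehension.

(** * Coding points by their distances to a reference sequence *)

Section decoding.
Context {R : realType} {d : measure_display} {Z : measurableType d}.
Variables (dd : bool -> Z -> Z -> R) (TS : Z -> Z).
Hypothesis ddxx : forall c z, dd c z z = 0.
Hypothesis ddC : forall c z z', dd c z z' = dd c z' z.
Hypothesis ddT : forall c x y z, dd c x z <= dd c x y + dd c y z.
Hypothesis dd_sep : forall z z', (forall c, dd c z z' = 0) -> z = z'.
Hypothesis mdd : forall c, measurable_fun setT (fun p : Z * Z => dd c p.1 p.2).
Hypothesis mTS : measurable_fun setT TS.
Hypothesis ultra_cvg : forall (A : Type) (U : set_system A), UltraFilter U ->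
  forall g : A -> Z, exists p, forall r, 0 < r -> U (g @^-1` nearby dd p r).

Local Notation E0 := (cylinderT (bool * nat)%type R).

(** Measurability through countably many cells on which the map oscillates little. It is kept
    abstract since on [X * Y] the sigma-algebra is a product one and the criterion is proved
    coordinate by coordinate. *)
Hypothesis measurable_locally : forall (f : E0 -> Z) (S : set E0) (C : nat -> set E0),
  measurable S -> (forall i, measurable (C i)) -> (forall o, ~ S o -> f o = point) ->
  (forall o r, S o -> 0 < r -> exists i, C i o /\
     forall o', S o' -> C i o' -> nearby dd (f o) r (f o')) ->
  measurable_fun setT f.

Let lip := dd_lip ddC ddT.

Definition adherence (w : nat -> Z) : set Z :=
  [set z | forall n, exists l, nearby dd z (radn n) (w l)].

Definition coord (w : nat -> Z) (z : Z) : E0 := fun i => dd i.1 z (w i.2).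

(** The closure, in the uniform distance, of the codes of the points [w k]; it proves to be the
    image of [adherence w] under [coord w]. Written through mutual distances alone, it is the same
    set for isometric sequences, and its countable quantifiers make it measurable. *)
Definition coord_range (w : nat -> Z) : set E0 :=
  [set e | forall n, exists k, forall l c, `|(e (c, l) : R) - dd c (w k) (w l)| <= (radn n)].

Lemma coord_rangeP w z : adherence w z -> coord_range w (coord w z).
Proof.
move=> wz n; have [k zk] := wz n; exists k => l c.
rewrite /coord /= ![dd c _ (w l)]ddC; apply: le_trans (lip _ _ _ _) _.
exact/ltW/zk.
Qed.

(** Compactness supplies the point: the index sets [S n] are nonempty and decreasing, and [z] is a
    limit of [w] along an ultrafilter containing all of them. *)
Lemma coord_range_surj w e : coord_range w e -> exists2 z, adherence w z & coord w z = e.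
Proof.
move=> we.
pose S n := [set k | forall l c, `|(e (c, l) : R) - dd c (w k) (w l)| <= (radn n)].
have FS : ProperFilter (filter_from setT S).
  apply: filter_from_proper; last by move=> n _; have [k ?] := we n; exists k.
  apply: filter_from_filter; first by exists 0%N.
  move=> i j _ _; exists (maxn i j) => // k H; split => l c;
    apply: le_trans (H l c) _; apply: le_radn; lia.
have [U [UU FU]] := ultraFilterLemma FS.
have [z zU] := @ultra_cvg _ U UU w.
exists z => [n|].
  have [l ?] := @filter_ex _ U _ _ (zU (radn n) (radn_gt0 n)); by exists l.
apply/funext => -[c l]; rewrite /coord /=.
apply: eq_of_dist_le => r r0.
have r20 : 0 < r / 2 by rewrite divr_gt0.
have [n nr] := small_radn r20.
have [k [zk ek]] : exists k, nearby dd z (r / 2) (w k) /\ S n k.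
  by apply: (@filter_ex _ U); apply: filterI; [exact: zU|apply: FU; exists n].
have := lip c z (w k) (w l); have := zk c; have := ek l c.
rewrite ![dd c (w l) _]ddC !ler_norml => /andP[? ?] ? /andP[? ?].
by apply/andP; split; lra.
Qed.

(** It is enough that [z] be adherent: a reference point close to [z] is, by equality of codes, as
    close to [z']. *)
Lemma coord_inj w z z' : adherence w z -> coord w z = coord w z' -> z = z'.
Proof.
move=> wz zz'; apply: dd_sep => c; apply: eq_of_dist_le => r r0.
rewrite subr0 (ger0_norm (dd_ge0 ddxx ddC ddT _ _ _)).
have r20 : 0 < r / 2 by rewrite divr_gt0.
have [n nr] := small_radn r20.
have [l zl] := wz n; have := zl c.
have := congr1 (fun e : E0 => e (c, l)) zz'; rewrite /coord /= => zz'l.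
have := ddT c z (w l) z'; rewrite [dd c (w l) z']ddC; lra.
Qed.

(** The default [point] off [coord_range w] is the value that [measurable_locally] prescribes
    there. *)
Definition decode (w : nat -> Z) (e : E0) : Z :=
  if pselect (coord_range w e) is left H then s2val (cid2 (coord_range_surj H)) else point.

Lemma decodeP w e : coord_range w e -> adherence w (decode w e) /\ coord w (decode w e) = e.
Proof. by rewrite /decode; case: pselect => // H _; case: cid2. Qed.

Lemma decode_coord w z : adherence w z -> decode w (coord w z) = z.
Proof.
move=> wz; have [a c] := decodeP (coord_rangeP wz).
by apply: (coord_inj a).
Qed.

Lemma measurable_coord_range w : measurable (coord_range w).
Proof.
apply: measurable_forall_nat => n; apply: measurable_exists_nat => k.
apply: measurable_forall_nat => l; apply: measurable_forall_bool => c.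
apply: measurable_le_cst; apply: measurableT_comp => //.
apply: measurable_funB => //; exact: measurable_coord.
Qed.

Lemma measurable_decode w : measurable_fun setT (decode w).
Proof.
(* Within the range, the cell coded by [(l, n)] consists of codes of points within [radn n] of
   [w l], so points decoded from one cell are less than [2 * radn n] apart. *)
pose C i := [set e : E0 | forall c,
  e (c, (odflt (0, 0)%N (unpickle i)).1) < radn (odflt (0, 0)%N (unpickle i)).2].
apply: (measurable_locally (S := coord_range w) (C := C)).
- exact: (@measurable_coord_range w).
- move=> i; apply: measurable_forall_bool => c; apply: measurable_lt_cst.
  exact: measurable_coord.
- by move=> e ne; rewrite /decode; case: pselect.
- move=> e r we r0; have r20 : 0 < r / 2 by rewrite divr_gt0.
  have [n nr] := small_radn r20.
  have [a ce] := decodeP we; have [l zl] := a n.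
  exists (pickle (l, n)); rewrite /C pickleK /=; split.
    by move=> c; rewrite -ce; exact: zl.
  move=> e' we' e'l c; have [a' ce'] := decodeP we'.
  have e'E : e' (c, l) = dd c (decode w e') (w l) by rewrite -[in LHS]ce'.
  have := zl c; have := e'l c; rewrite e'E.
  have := ddT c (decode w e) (w l) (decode w e').
  by rewrite [dd c (w l) (decode w e')]ddC; lra.
Qed.

Lemma measurable_coordf w : measurable_fun setT (coord w).
Proof. by apply: measurable_cylinderT => i; exact: measurable_dd. Qed.

(** Adherence as an event on codes that does not mention the sequence: equality of laws thus carries
    almost sure adherence from [P] to [P']. *)
Definition adherence_code : set E0 :=
  [set e | forall n, exists l, forall c, e (c, l) < (radn n)].

Lemma measurable_adherence_code : measurable adherence_code.
Proof.
apply: measurable_forall_nat => n; apply: measurable_exists_nat => l.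
apply: measurable_forall_bool => c; apply: measurable_lt_cst; exact: measurable_coord.
Qed.

Lemma measurable_adherence w : measurable (adherence w).
Proof.
rewrite (_ : adherence w = setT `&` coord w @^-1` adherence_code) ?setTI//.
by have := measurable_coordf w measurableT measurable_adherence_code; rewrite setTI.
Qed.

Definition base (e : cylinderT (bool * nat * nat) R) : E0 := fun i => e (i.1, 0, i.2)%N.

Lemma measurable_base : measurable_fun setT base.
Proof. by apply: measurable_cylinderT => i; exact: measurable_coord. Qed.

Lemma base_profile w z : base (profile dd TS w z) = coord w z.
Proof. by []. Qed.

Definition same_law (P P' : probability Z R) w w' := forall B, measurable B ->
  P (profile dd TS w @^-1` B) = P' (profile dd TS w' @^-1` B).

Lemma same_law_coord P P' w w' B : same_law P P' w w' -> measurable B ->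
  P (coord w @^-1` B) = P' (coord w' @^-1` B).
Proof.
move=> H mB; have mb : measurable (base @^-1` B).
  by have := measurable_base measurableT mB; rewrite setTI.
exact: H mb.
Qed.

Lemma same_law_adherence P P' w w' : same_law P P' w w' ->
  {ae P, forall z, adherence w z} -> {ae P', forall z, adherence w' z}.
Proof.
move=> H /ae_prob1-/(_ (measurable_adherence w)) wP.
apply: prob1_ae; first exact: measurable_adherence.
rewrite -wP; apply/esym.
exact: (same_law_coord H measurable_adherence_code).
Qed.

Definition transport w w' (z : Z) : Z := decode w' (coord w z).

Lemma measurable_transport w w' : measurable_fun setT (transport w w').
Proof. exact: (measurableT_comp (measurable_decode w') (measurable_coordf w)). Qed.

Lemma transport_law P P' w w' A : same_law P P' w w' ->
  {ae P', forall z, adherence w' z} -> measurable A ->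
  P (transport w w' @^-1` A) = P' A.
Proof.
move=> H w'P' mA.
have mdA : measurable (decode w' @^-1` A).
  by have := measurable_decode w' measurableT mA; rewrite setTI.
have -> := same_law_coord H mdA.
have m1 : measurable (coord w' @^-1` (decode w' @^-1` A)).
  by have := measurable_coordf w' measurableT mdA; rewrite setTI.
apply: eq_measure_ae => //.
by apply: filterS w'P' => z wz /=; rewrite decode_coord.
Qed.

Variables (w w' : nat -> Z).
Hypothesis ww' : forall c k l, dd c (w k) (w l) = dd c (w' k) (w' l).

Lemma coord_range_eq : coord_range w = coord_range w'.
Proof.
by apply/seteqP; split => e we n; have [k H] := we n; exists k => l c;
  have := H l c; rewrite ww'.
Qed.

Lemma transportP z : adherence w z ->
  adherence w' (transport w w' z) /\ coord w' (transport w w' z) = coord w z.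
Proof. by move=> wz; apply: decodeP; rewrite -coord_range_eq; exact: coord_rangeP. Qed.

Lemma transportK z : adherence w z -> transport w' w (transport w w' z) = z.
Proof. by move=> wz; rewrite /transport (transportP wz).2 decode_coord. Qed.

(* The set of codes [e] with [e i = profile w' (decode w' (base e)) i] has full
   measure for the law of [profile w'], hence for the law of [profile w]. *)
Lemma transport_profile P P' : same_law P P' w w' -> {ae P', forall z, adherence w' z} ->
  {ae P, forall z, forall i, profile dd TS w z i = profile dd TS w' (transport w w' z) i}.
Proof.
move=> H w'P'; apply: ae_forall_count => i.
pose B := [set e : cylinderT (bool * nat * nat) R |
  e i = profile dd TS w' (decode w' (base e)) i].
have mB : measurable B.
  apply: measurable_eq_fun; first exact: measurable_coord.
  apply: (@measurableT_comp _ _ _ _ Z _ (fun z => profile dd TS w' z i) _ (decode w' \o base)).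
  - apply: measurable_dd => //; exact: measurable_iterTS.
  - exact: (measurableT_comp (measurable_decode w') measurable_base).
have mpB v : measurable (profile dd TS v @^-1` B).
  by have := measurable_profile mdd mTS v measurableT mB; rewrite setTI.
apply: (prob1_ae (mpB w)); rewrite H//; apply: ae_prob1 => //.
by apply: filterS w'P' => z wz; rewrite /B /= base_profile decode_coord.
Qed.

(** Both distances are compared through a reference point [w l] close to the iterate of [z']: the
    profiles record every iterate, so [w' l] is equally close to the transported iterate and equally
    far from the other one. Commutation of [transport] with [TS] does not enter. *)
Lemma transport_kernel z z' :
  (forall i, profile dd TS w z i = profile dd TS w' (transport w w' z) i) ->
  (forall i, profile dd TS w z' i = profile dd TS w' (transport w w' z') i) ->
  (forall a, adherence w (iter a TS z')) ->
  forall c a b, dd c (iter a TS z) (iter b TS z') =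
    dd c (iter a TS (transport w w' z)) (iter b TS (transport w w' z')).
Proof.
move=> zU z'U wz' c a b; apply: eq_of_dist_le => r r0.
have r20 : 0 < r / 2 by rewrite divr_gt0.
have [n nr] := small_radn r20.
have [l zl] := wz' b n; have := zl c.
have := zU (c, a, l); have := z'U (c, b, l); rewrite /profile /=.
set u := iter a TS z; set v := iter b TS z'.
set u' := iter a TS (transport _ _ z); set v' := iter b TS (transport _ _ z').
move=> e1 e2 vl; have := lip c v (w l) u; have := lip c v' (w' l) u'.
rewrite !ler_norml => /andP[? ?] /andP[? ?]; apply/andP; split; lra.
Qed.

(** Agreement is stated for all pairs from one set [E] of full measure, not almost everywhere for
    the product measure, because the marks are values on the diagonal, which may be a null set. *)
Lemma transport_iso (P P' : probability Z R) : same_law P P' w w' ->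
  {ae P, forall z, adherence w z} ->
  (forall A, measurable A -> P (TS @^-1` A) = P A) ->
  mspace_iso P P' (transport w w') /\
  exists E : set Z, {ae P, forall z, E z} /\ forall z z', E z -> E z' -> forall c a b,
    dd c (iter a TS z) (iter b TS z') =
    dd c (iter a TS (transport w w' z)) (iter b TS (transport w w' z')).
Proof.
move=> H wP inv; have w'P' := same_law_adherence H wP.
have H' : same_law P' P w' w by move=> B mB; rewrite H.
split.
  split; first exact: measurable_transport.
    by move=> A mA; exact: transport_law.
  exists (transport w' w); split.
  - exact: measurable_transport.
  - by move=> A mA; exact: transport_law.
  - by apply: filterS wP => z; exact: transportK.
  - apply: filterS w'P' => z wz; rewrite /transport.
    have [] := @decodeP w (coord w' z); first by rewrite coord_range_eq; exact: coord_rangeP.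
    by move=> _ ->; rewrite decode_coord.
exists [set z | (forall i, profile dd TS w z i = profile dd TS w' (transport w w' z) i) /\
  forall a, adherence w (iter a TS z)]; split; last first.
  by move=> z z' [zU _] [z'U wz'] c a b; exact: transport_kernel.
apply: filterS2 (transport_profile H w'P') _; last first.
  (* By invariance each iterate has law [P], so almost surely the whole orbit is adherent to [w]. *)
  apply: (@ae_forall_count _ _ _ P nat (fun a z => adherence w (iter a TS z))) => a.
  have ma k : measurable (iter k TS @^-1` adherence w).
    have := measurable_iterTS mTS k measurableT (measurable_adherence w).
    by rewrite setTI.
  apply: prob1_ae; first exact: ma.
  rewrite -[RHS](ae_prob1 (measurable_adherence w) wP).
  elim: a => [//|a IH]; rewrite -IH -(inv _ (ma a)); congr (P _).
  by apply/seteqP; split => z /=; rewrite -iterSr.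
by move=> z.
Qed.
End decoding.

(** * Supports and reference sequences *)

Section support.
Context {R : realType} {d : measure_display} {Z : measurableType d}.
Variables (dd : bool -> Z -> Z -> R) (TS : Z -> Z).
Hypothesis ddxx : forall c z, dd c z z = 0.
Hypothesis ddC : forall c z z', dd c z z' = dd c z' z.
Hypothesis ddT : forall c x y z, dd c x z <= dd c x y + dd c y z.
Hypothesis mdd : forall c, measurable_fun setT (fun p : Z * Z => dd c p.1 p.2).
Hypothesis mTS : measurable_fun setT TS.
Variable zs : nat -> Z.
Hypothesis dense : forall z r, 0 < r -> exists i, nearby dd z r (zs i).
Variable P : probability Z R.

Definition msupport : set Z := [set z | forall r, 0 < r -> (0 < P (nearby dd z r))%E].

(** Discard the null balls among the countably many with dense centres and radii [radn]: any ball
    around a remaining point contains one of these balls through that point, which has positive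
    mass. *)
Lemma ae_support : {ae P, forall z, msupport z}.
Proof.
pose Q (q : nat * nat) (z : Z) := nearby dd (zs q.1) (radn q.2) z ->
  (0 < P (nearby dd (zs q.1) (radn q.2)))%E.
have : {ae P, forall z, forall q, Q q z}.
  apply: ae_forall_count => q; have mq := measurable_nearby mdd (zs q.1) (radn q.2).
  have [q0|q0] := ltP 0%E (P (nearby dd (zs q.1) (radn q.2))).
    by apply: filterS filterT => z _ _.
  exists (nearby dd (zs q.1) (radn q.2)); split => //.
    by apply/eqP; rewrite eq_le q0 /=.
  by move=> z /not_implyP[].
apply: filterS => z Qz r r0; have r20 : 0 < r / 2 by rewrite divr_gt0.
have [n nr] := small_radn r20.
have n0 : 0 < radn n :> R by exact: radn_gt0.
have [i zi] := dense z n0.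
apply: (@lt_le_trans _ _ (P (nearby dd (zs i) (radn n)))).
  by apply: (Qz (i, n)) => c /=; rewrite ddC; exact: zi.
apply: le_measure; rewrite ?inE; try exact: measurable_nearby.
by move=> z' iz' c; have := ddT c z (zs i) z'; have := zi c; have := iz' c; lra.
Qed.

(** Each of the countably many basic balls that meets the support contributes a support point of its
    own; for the others [s0], available since the support has full measure, fills the index. *)
Lemma dense_in_support : exists w : nat -> Z,
  (forall l, msupport (w l)) /\ {ae P, forall z, adherence dd w z}.
Proof.
have [s0 s0P] := ae_exists ae_support.
have pick (q : nat * nat) : {s | msupport s /\
    forall z, msupport z -> nearby dd (zs q.1) (radn q.2) z ->
      nearby dd (zs q.1) (radn q.2) s}.
  apply: cid; have [[s [ss sq]]|] := pselect (exists s, msupport s /\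
    nearby dd (zs q.1) (radn q.2) s); first by exists s.
  by move=> no; exists s0; split => // z sz zq; case: no; exists z.
pose w n := sval (pick (odflt (0, 0)%N (unpickle n))).
exists w; split; first by move=> l; exact: (svalP (pick _)).1.
apply: filterS ae_support => z sz n.
have n0 : 0 < radn n / 2 :> R by rewrite divr_gt0// radn_gt0.
have [m mn] := small_radn n0.
have m0 : 0 < radn m :> R by exact: radn_gt0.
have [i zi] := dense z m0; exists (pickle (i, m)).
have := (svalP (pick (i, m))).2 z sz; rewrite /w pickleK /= => H c.
have iz : nearby dd (zs i) (radn m) z by move=> c'; rewrite ddC; exact: zi.
have := H iz c; have := zi c; have := ddT c z (zs i) (sval (pick (i, m))); lra.
Qed.

(** Points near [w k] have positive probability and nearly its distance to [w l]. By equality of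
    laws the corresponding event for [w'] has positive probability, so some [z] is near [w' k] and
    at nearly that distance from [w' l]. *)
Lemma isometric_sequences (P' : probability Z R) w w' :
  (forall l, msupport (w l)) -> same_law dd TS P P' w w' ->
  forall c k l, dd c (w k) (w l) = dd c (w' k) (w' l).
Proof.
move=> sw H c k l; apply: eq_of_dist_le => r r0.
have r20 : 0 < r / 2 by rewrite divr_gt0.
pose B := [set e : cylinderT (bool * nat * nat) R |
   `|(e (c, 0%N, l) : R) - dd c (w k) (w l)| <= r / 2] `&`
   [set e | e (c, 0%N, k) <= r / 2].
have mB : measurable B.
  apply: measurableI.
  - apply: measurable_le_cst; apply: measurableT_comp => //.
    apply: measurable_funB => //; exact: measurable_coord.
  - apply: measurable_le_cst; exact: measurable_coord.
have : (0 < P' (profile dd TS w' @^-1` B))%E.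
  rewrite -H//; apply: lt_le_trans (sw k _ r20) _.
  apply: le_measure; rewrite ?inE; first exact: measurable_nearby.
  - by have := measurable_profile mdd mTS w measurableT mB; rewrite setTI.
  - move=> z kz; split; rewrite /profile /=.
    + rewrite ![dd c _ (w l)]ddC distrC; apply: le_trans (dd_lip ddC ddT _ _ _ _) _.
      exact/ltW/kz.
    + by rewrite ddC; exact/ltW/kz.
have [[z [/= zl zk]] _|noz] := pselect (exists z, B (profile dd TS w' z)); last first.
  rewrite (_ : _ @^-1` B = set0) ?measure0 ?ltxx//.
  by apply/seteqP; split => // z Bz; apply: noz; exists z.
move: zl zk; rewrite /profile /= => zl zk.
have := dd_lip ddC ddT c z (w' k) (w' l); move: zl.
rewrite ![dd c (w' l) _]ddC !ler_norml => /andP[? ?] /andP[? ?]; apply/andP; split; lra.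
Qed.
End support.

(** * Compact metric spaces and their products *)

Section metric_space.
Context {R : realType} {d : measure_display} {X : measurableType d}.
Variable dist : X -> X -> R.
Hypothesis metX : is_metric dist.
Hypothesis cptX : metric_compact dist.
Hypothesis borX : metric_borel dist.

Lemma distxx x : dist x x = 0. Proof. by case: metX => _ H _ _; apply/H. Qed.
Lemma dist_eq0 x y : dist x y = 0 -> x = y. Proof. by case: metX => _ H _ _ /H. Qed.
Lemma distC x y : dist x y = dist y x. Proof. by case: metX. Qed.
Lemma dist_triangle x y z : dist x z <= dist x y + dist y z. Proof. by case: metX. Qed.

Lemma open_ball x r : metric_open dist [set y | dist x y < r].
Proof.
move=> y /= xy; exists (r - dist x y); first by rewrite subr_gt0.
by move=> z /= yz; have := dist_triangle x y z; lra.
Qed.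

Lemma measurable_ball x r : measurable [set y | dist x y < r].
Proof. by rewrite borX; apply: sub_sigma_algebra; exact: open_ball. Qed.

(** If there were no limit, finitely many balls whose preimages are not in [U] would cover the
    space, against primality of the ultrafilter. *)
Lemma metric_ultra_cvg (A : Type) (U : set_system A) : UltraFilter U ->
  forall g : A -> X, exists p, forall r : R, 0 < r -> U [set a | dist p (g a) < r].
Proof.
move=> UU g; apply: contrapT => /forallNP nolim.
have bad p : {r : R | 0 < r /\ ~ U [set a | dist p (g a) < r]}.
  by apply: cid; have /existsNP[r /not_implyP[r0 H]] := nolim p; exists r.
pose B p := [set y | dist p y < sval (bad p)].
have [|s Us] := cptX (fun p => @open_ball p (sval (bad p))).
  by apply/seteqP; split => // x _; exists x => //=; rewrite distxx; exact: (svalP (bad x)).1.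
suff H : forall s' : seq X, ~ U (g @^-1` (\big[setU/set0]_(i <- s') B i)).
  by apply: (H s); rewrite Us; exact: filterT.
elim=> [|p s' IH]; first by rewrite big_nil preimage_set0; exact: filter_not_empty.
rewrite big_cons preimage_setU => H.
have [Up|Up] := in_ultra_setVsetC (g @^-1` B p) UU; first exact: (svalP (bad p)).2.
by apply: IH; apply: filterS2 H Up => a [].
Qed.

Lemma metric_dense : exists xs : nat -> X, forall x (r : R), 0 < r -> exists i, dist x (xs i) < r.
Proof.
have net n : {s : seq X | forall x, exists2 y, List.In y s & dist y x < radn n}.
  apply: cid; have [|s Us] := cptX (fun p => @open_ball p (radn n)).
    by apply/seteqP; split => // x _; exists x => //=; rewrite distxx radn_gt0.
  exists s => x; have : [set: X] x by []. rewrite -Us; elim: s {Us} => [|p s IH].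
    by rewrite big_nil.
  rewrite big_cons => -[px|/IH[y ys yx]]; first by exists p => //; left.
  by exists y => //; right.
have In_nth (s : seq X) y : List.In y s -> exists i, nth point s i = y.
  elim: s => [//|z s IH] [->|/IH[i <-]]; [by exists 0%N|by exists i.+1].
exists (fun k => let q := odflt (0, 0)%N (unpickle k) in nth point (sval (net q.1)) q.2).
move=> x r r0; have [n nr] := small_radn r0.
have [y /In_nth[i yE] yx] := svalP (net n) x.
by exists (pickle (n, i)); rewrite pickleK /= yE distC; exact: lt_trans nr.
Qed.

Lemma metric_measurable_locally {d'} {O : measurableType d'} (f : O -> X) (S : set O)
    (C : nat -> set O) :
  measurable S -> (forall i, measurable (C i)) -> (forall o, ~ S o -> f o = point) ->
  (forall o r, S o -> 0 < r -> exists i, C i o /\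
     forall o', S o' -> C i o' -> dist (f o) (f o') < r) ->
  measurable_fun setT f.
Proof.
move=> mS mC fS loc; apply: (measurability _ borX) => _ [V oV <-]; rewrite setTI.
pose D := [set i | S `&` C i `<=` f @^-1` V].
(* Off [S] the map is constant, so the complement of [S] belongs to the preimage entirely or not at
   all, according to whether [V] contains [point]. *)
have -> : f @^-1` V = (\bigcup_(i in D) (S `&` C i)) `|`
    (if `[< V point >] then ~` S else set0).
  apply/seteqP; split => o.
  - move=> Vo; have [So|So] := pselect (S o); last first.
      right; have Vp : V point by rewrite -(fS o So).
      by case: asboolP.
    have [r r0 rV] := oV _ Vo; have [i [Cio iP]] := loc o r So r0.
    by left; exists i => // o' [So' Cio']; apply: rV; exact: iP.
  - by move=> [[i Di SC]|]; [exact: Di|case: asboolP => // Vp /fS fo; rewrite /preimage/= fo].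
apply: measurableU; last by case: ifP => _ //; exact: measurableC.
by apply: bigcup_measurable => i _; exact: measurableI.
Qed.

Let lt_split (a b c r q : R) : c <= a + b -> a < q -> q < (r - b) / 2 -> c < r - q.
Proof. lra. Qed.

Let lt_join (a b c r q : R) : c <= a + b -> a < q -> b < r - q -> c < r.
Proof. lra. Qed.

(** The sigma-algebra on [X * X] is generated by rectangles, so separability is called upon to write
    each sublevel set as a countable union of products of balls. *)
Lemma measurable_dist : measurable_fun setT (fun p : X * X => dist p.1 p.2).
Proof.
have [xs dense] := metric_dense.
apply: (measurability _ (RGenInftyO.measurableE R)) => _ [_ [r ->] <-]; rewrite setTI.
have -> : (fun p : X * X => dist p.1 p.2) @^-1` `]-oo, r[ =
  [set p | exists i, exists n, (([set x | dist (xs i) x < radn n]) `*`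
                                ([set y | dist (xs i) y < r - radn n])) p].
  apply/seteqP; split => -[x y] /=; rewrite in_itv /=.
  - move=> xy; have d0 : 0 < (r - dist x y) / 2 by rewrite divr_gt0 ?subr_gt0.
    have [n nr] := small_radn d0.
    have [i xi] := dense x _ (radn_gt0 n).
    exists i, n; split => /=; first by rewrite distC.
    apply: lt_split nr; last exact: xi.
    by rewrite (distC x); exact: dist_triangle.
  - by move=> [i [n [/= xi iy]]]; apply: lt_join xi iy; rewrite (distC _ x); exact: dist_triangle.
apply: measurable_exists_nat => i; apply: measurable_exists_nat => n.
by apply: measurableX; exact: measurable_ball.
Qed.
End metric_space.

Section product_distances.
Context {R : realType} {d1 d2 : measure_display} {X : measurableType d1} {Y : measurableType d2}.
Variables (dX : X -> X -> R) (dY : Y -> Y -> R).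
Hypotheses (mX : is_metric dX) (cX : metric_compact dX) (bX : metric_borel dX).
Hypotheses (mY : is_metric dY) (cY : metric_compact dY) (bY : metric_borel dY).

Definition pdist (c : bool) (z z' : X * Y) : R :=
  if c then dY z.2 z'.2 else dX z.1 z'.1.

Lemma pdistxx c z : pdist c z z = 0.
Proof. by rewrite /pdist; case: c; exact: distxx. Qed.

Lemma pdistC c z z' : pdist c z z' = pdist c z' z.
Proof. by rewrite /pdist; case: c; exact: distC. Qed.

Lemma pdist_triangle c x y z : pdist c x z <= pdist c x y + pdist c y z.
Proof. by rewrite /pdist; case: c; exact: dist_triangle. Qed.

Lemma pdist_sep z z' : (forall c, pdist c z z' = 0) -> z = z'.
Proof.
case: z z' => x y [x' y'] H.
by have /= -> := dist_eq0 mX (H false); have /= -> := dist_eq0 mY (H true).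
Qed.

Lemma measurable_pdist c : measurable_fun setT (fun p : (X * Y) * (X * Y) => pdist c p.1 p.2).
Proof.
rewrite /pdist; case: c.
- exact: (measurableT_comp (measurable_dist mY cY bY) (measurable_fun_pair
    (measurableT_comp measurable_snd measurable_fst)
    (measurableT_comp measurable_snd measurable_snd))).
- exact: (measurableT_comp (measurable_dist mX cX bX) (measurable_fun_pair
    (measurableT_comp measurable_fst measurable_fst)
    (measurableT_comp measurable_fst measurable_snd))).
Qed.

Lemma pdist_ultra_cvg (A : Type) (U : set_system A) : UltraFilter U ->
  forall g : A -> X * Y, exists p, forall r, 0 < r -> U (g @^-1` nearby pdist p r).
Proof.
move=> UU g.
have [p pP] := metric_ultra_cvg mX cX UU (fun a => (g a).1).
have [q qP] := metric_ultra_cvg mY cY UU (fun a => (g a).2).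
exists (p, q) => r r0; apply: filterS2 (pP r r0) (qP r r0).
by move=> a pa qa; case.
Qed.

Lemma pdist_dense : exists zs : nat -> X * Y, forall z r, 0 < r ->
  exists i, nearby pdist z r (zs i).
Proof.
have [xs xP] := metric_dense mX cX; have [ys yP] := metric_dense mY cY.
exists (fun k => let q := odflt (0, 0)%N (unpickle k) in (xs q.1, ys q.2)).
move=> z r r0; have [i xi] := xP z.1 r r0; have [j yj] := yP z.2 r r0.
by exists (pickle (i, j)); rewrite pickleK; case.
Qed.

Lemma pdist_measurable_locally {d'} {O : measurableType d'} (f : O -> X * Y) (S : set O)
    (C : nat -> set O) :
  measurable S -> (forall i, measurable (C i)) -> (forall o, ~ S o -> f o = point) ->
  (forall o r, S o -> 0 < r -> exists i, C i o /\
     forall o', S o' -> C i o' -> nearby pdist (f o) r (f o')) ->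
  measurable_fun setT f.
Proof.
move=> mS mC fS loc; apply/measurable_fun_pairP; split.
- apply: (metric_measurable_locally bX mS mC) => [e /fS /= ->//|e r Se r0].
  have [i [Cio iP]] := loc e r Se r0; exists i; split => // o' So' Cio'.
  exact: iP So' Cio' false.
- apply: (metric_measurable_locally bY mS mC) => [e /fS /= ->//|e r Se r0].
  have [i [Cio iP]] := loc e r Se r0; exists i; split => // o' So' Cio'.
  exact: iP So' Cio' true.
Qed.
End product_distances.

(** * Kernel isomorphisms and twins *)

Section measure_preserving.
Context {R : realType} {d1 d2 : measure_display}.
Context {T1 : measurableType d1} {T2 : measurableType d2}.
Variables (P1 : probability T1 R) (P2 : probability T2 R) (U : T1 -> T2).
Hypothesis mU : measurable_fun setT U.
Hypothesis PU : forall A, measurable A -> P1 (U @^-1` A) = P2 A.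

Lemma ae_preimage (A : T2 -> Prop) : {ae P2, forall y, A y} -> {ae P1, forall x, A (U x)}.
Proof.
move=> [N [mN N0 AN]]; exists (U @^-1` N); split.
- by have := mU measurableT mN; rewrite setTI.
- exact: etrans (PU mN) N0.
- by move=> x /AN.
Qed.

(** The image of [P1 \x P1] under [U] in both coordinates agrees with [P2 \x P2] on rectangles,
    hence everywhere. *)
Lemma ae_preimage_prod (A : T2 * T2 -> Prop) : {ae (P2 \x P2)%E, forall p, A p} ->
  {ae (P1 \x P1)%E, forall p : T1 * T1, A (U p.1, U p.2)}.
Proof.
move=> [N [mN N0 AN]]; pose UU (p : T1 * T1) := (U p.1, U p.2).
have mUU : measurable_fun setT UU.
  by apply: measurable_fun_pair; apply: measurableT_comp.
pose f : {mfun (T1 * T1)%type >-> (T2 * T2)%type} := HB.pack UU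
  (isMeasurableFun.Build _ _ _ _ UU mUU).
exists (UU @^-1` N); split.
- by have := mUU measurableT _ mN; rewrite setTI.
- rewrite -[RHS]N0; apply/esym.
  apply: (@product_measure_unique _ _ _ _ _ P2 P2 (distribution (P1 \x P1)%E f)) => // B1 B2 mB1 mB2.
  rewrite /distribution /pushforward /=.
  rewrite (_ : _ @^-1` _ = (U @^-1` B1) `*` (U @^-1` B2))//.
  rewrite product_measure1E /= ?PU//.
  + by have := mU measurableT mB1; rewrite setTI.
  + by have := mU measurableT mB2; rewrite setTI.
- by move=> p /AN.
Qed.
End measure_preserving.

Section kernel_isomorphisms.
Context {R : realType} {I J : Type}.

Lemma kernel_isomorphic_sym (K1 K2 : mck_space R I J) :
  kernel_isomorphic K1 K2 -> kernel_isomorphic K2 K1.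
Proof.
move=> [U [[mU PU [V [mV PV VU UV]]] marks kers]]; exists V; split.
- by split => //; exists U.
- move=> alpha; apply: filterS2 (ae_preimage mV PV (marks alpha)) UV.
  by move=> y /= -> ->.
- move=> c; apply: filterS2 (ae_preimage_prod mV PV (kers c)) (ae_prod UV).
  by move=> [x y] /= -> [-> ->].
Qed.

Lemma kernel_isomorphic_trans (K1 K2 K3 : mck_space R I J) :
  kernel_isomorphic K1 K2 -> kernel_isomorphic K2 K3 -> kernel_isomorphic K1 K3.
Proof.
move=> [U [[mU PU [V [mV PV VU UV]]] mark1 ker1]].
move=> [U' [[mU' PU' [V' [mV' PV' VU' UV']]] mark2 ker2]].
have mpre da db (Ta : measurableType da) (Tb : measurableType db) (f : Ta -> Tb) A :
    measurable_fun setT f -> measurable A -> measurable (f @^-1` A).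
  by move=> mf mA; have := mf measurableT A mA; rewrite setTI.
exists (U' \o U); split.
- split; first exact: measurableT_comp.
    by move=> A mA; rewrite comp_preimage PU ?PU'//; exact: mpre.
  exists (V \o V'); split; first exact: measurableT_comp.
  + by move=> A mA; rewrite comp_preimage PV' ?PV//; exact: mpre.
  + by apply: filterS2 (ae_preimage mU PU VU') VU => x /= -> ->.
  + by apply: filterS2 (ae_preimage mV' PV' UV) UV' => x /= -> ->.
- move=> alpha; apply: filterS2 (mark1 alpha) (ae_preimage mU PU (mark2 alpha)).
  by move=> x -> /= ->.
- move=> c; apply: filterS2 (ker1 c) (ae_preimage_prod mU PU (ker2 c)).
  by move=> x -> /= ->.
Qed.

(** A point outside [N] has no twin at all, not even inside [N]. So [N] is a union of twin classes,
    [pi] is injective off it, and the quotient sigma-algebra makes a section measurable. *)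
Lemma twin_free_quotient_iso (K Q : mck_space R I J) (pi : mck_T K -> mck_T Q) :
  {ae mck_P K, forall z, forall z', twins K z' z -> z' = z} ->
  twin_free_quotient K Q pi -> kernel_isomorphic K Q.
Proof.
move=> [N [mN N0 twinN]] [_ [_ piE] [mpi Ppi] marks kers].
have notN z z' : ~ N z -> twins K z' z -> z' = z.
  by move=> Nz; apply: contrapT => H; apply: Nz; apply: twinN => /(_ z')/H.
have mpiT : measurable_fun setT pi by move=> _ A mA; rewrite setTI; exact/mpi.
(* Classes inside [N] all go to [point]; the pullback under [pi] of a preimage under [sec] is then a
   set outside [N] together with all or none of [N]. *)
pose sec q := if pselect (exists z, ~ N z /\ pi z = q) is left H then sval (cid H) else point.
have secK z : ~ N z -> sec (pi z) = z.
  move=> Nz; rewrite /sec; case: pselect => [H|[]]; last by exists z.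
  by case: cid => z' [/= Nz' pz']; apply: notN => //; apply/piE.
have sec_out z : N z -> sec (pi z) = point.
  move=> Nz; rewrite /sec; case: pselect => // -[z' [Nz' pz']].
  have zz' : z = z' by apply: notN => //; apply/piE.
  by exfalso; apply: Nz'; rewrite -zz'.
have msec : measurable_fun setT sec.
  move=> _ A mA; rewrite setTI; apply/mpi.
  rewrite (_ : pi @^-1` _ = (~` N `&` A) `|` (if `[< A point >] then N else set0)).
    apply: measurableU; first by apply: measurableI => //; exact: measurableC.
    by case: ifP.
  apply/seteqP; split => z /=.
  - have [Nz|Nz] := pselect (N z); last by rewrite secK//; left.
    by rewrite sec_out// => Ap; right; case: asboolP.
  - move=> [[Nz Az]|]; first by rewrite secK.
    by case: asboolP => // Ap Nz; rewrite sec_out.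
have aeN : {ae mck_P K, forall z, ~ N z}.
  by exists N; split => // z /contrapT.
have mpre A : measurable A -> measurable (sec @^-1` A).
  by move=> mA; have := msec measurableT A mA; rewrite setTI.
exists pi; split.
- split => //; first by move=> A mA; rewrite Ppi.
  exists sec; split => //.
  + move=> A mA; rewrite Ppi; last exact: mpre.
    apply: eq_measure_ae => //; first exact/mpi/mpre.
    by apply: filterS aeN => z Nz /=; rewrite secK.
  + by apply: filterS aeN => z Nz; exact: secK.
  + pose B := [set q | exists z, ~ N z /\ pi z = q].
    have piB : pi @^-1` B = ~` N.
      apply/seteqP; split => z /=; last by exists z.
      by move=> [z' [Nz' pz']]; rewrite (notN z' z)//; apply/piE.
    have mB : measurable B by apply/mpi; rewrite piB; exact: measurableC.
    have : {ae mck_P Q, forall q, B q}.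
      apply: prob1_ae => //; rewrite Ppi// piB.
      by apply: ae_prob1 => //; exact: measurableC.
    by apply: filterS => q [z [Nz <-]]; rewrite secK.
- by move=> alpha; apply: filterS filterT => z _; exact: marks.
- exact: kers.
Qed.
End kernel_isomorphisms.

(** * From array laws of joinings to isomorphisms *)

Section joinings.
Context {R : realType} {dx dy : measure_display} {X : measurableType dx} {Y : measurableType dy}.
Variables (dX : X -> X -> R) (mu : probability X R) (T : X -> X).
Variables (dY : Y -> Y -> R) (nu : probability Y R) (S : Y -> Y).
Hypotheses (sysX : cmmps dX mu T) (sysY : cmmps dY nu S).

Let TS (z : X * Y) : X * Y := (T z.1, S z.2).

Let mX : is_metric dX. Proof. by case: sysX. Qed.
Let cX : metric_compact dX. Proof. by case: sysX. Qed.
Let bX : metric_borel dX. Proof. by case: sysX. Qed.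
Let mY : is_metric dY. Proof. by case: sysY. Qed.
Let cY : metric_compact dY. Proof. by case: sysY. Qed.
Let bY : metric_borel dY. Proof. by case: sysY. Qed.

Let iter_TS a z : iter a TS z = (iter a T z.1, iter a S z.2).
Proof. by elim: a => [|a IH]; [case: z|rewrite /= IH]. Qed.

Let mTS : measurable_fun setT TS.
Proof.
have [_ _ _ mT _] := sysX; have [_ _ _ mS _] := sysY.
by apply: measurable_fun_pair; apply: measurableT_comp.
Qed.

Let kerE (lam : probability (X * Y)%type R) c a b z z' :
  mck_ker (K_lam dX T dY S lam) (c, a, b) z z' =
  pdist dX dY c (iter a TS z) (iter b TS z').
Proof. by rewrite /pdist !iter_TS; case: c. Qed.

Let markE (lam : probability (X * Y)%type R) c a b z :
  mck_mark (K_lam dX T dY S lam) (c, a, b) z =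
  pdist dX dY c (iter a TS z) (iter b TS z).
Proof. by rewrite /pdist !iter_TS; case: c. Qed.

Lemma array_laws_iso (lam lam' : probability (X * Y)%type R) :
  joining mu T nu S lam ->
  (forall n m : nat, (0 < n)%N -> (0 < m)%N -> Phi_eq dX T dY S n m lam lam') ->
  exists U, kernel_iso_via (K_lam dX T dY S lam) (K_lam dX T dY S lam') U.
Proof.
move=> [_ _ inv] PhiE.
pose dd := pdist dX dY.
have ddxx := pdistxx mX mY; have ddC := pdistC mX mY; have ddT := pdist_triangle mX mY.
have mdd := measurable_pdist mX cX bX mY cY bY.
have ultra := pdist_ultra_cvg mX cX mY cY.
have [zs zsP] := pdist_dense mX cX mY cY.
have [w [wS wP]] := dense_in_support ddC ddT mdd zsP lam.
have PhiE' n m : (0 < n)%N -> (0 < m)%N -> forall B, measurable B ->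
    nfold_prod lam n (@darr _ _ _ dd TS n m @^-1` B) =
    nfold_prod lam' n (@darr _ _ _ dd TS n m @^-1` B).
  move=> n0 m0 B mB; have -> : @darr _ _ _ dd TS n m = dist_arrays dX T dY S n m.
    apply/funext => z; apply/funext => -[[[[c i] j] a] b].
    by rewrite /darr /dd /pdist !iter_TS /=; case: c.
  exact: PhiE.
have [w' ww'] := matching_sequence ddC ddT mdd mTS PhiE' ultra wS.
have law := profile_law mdd mTS ww'.
have iso := isometric_sequences ddC ddT mdd mTS wS law.
have [Uiso [E [aeE EK]]] := transport_iso ddxx ddC ddT (pdist_sep mX mY) mdd mTS ultra
  (fun f => pdist_measurable_locally bX bY (f := f)) iso law wP inv.
exists (transport ddC ddT ultra w w'); split => //.
- by move=> [[c a] b]; apply: filterS aeE => z Ez; rewrite !markE; exact: EK.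
- move=> [[c a] b]; apply: filterS (ae_prod aeE) => -[z z'] [Ez Ez'].
  by rewrite !kerE; exact: EK.
Qed.

(* Evaluating the distances to [z] at points near [z] shows that a twin of a
   point of the support coincides with it. *)
Lemma twin_of_support (lam : probability (X * Y)%type R) z z' :
  msupport (pdist dX dY) lam z -> twins (K_lam dX T dY S lam) z' z -> z' = z.
Proof.
move=> sz [_ tw]; apply: (pdist_sep mX mY) => c.
apply: eq_of_dist_le => r r0; rewrite subr0.
rewrite ger0_norm; last exact: (dd_ge0 (pdistxx mX mY) (pdistC mX mY) (pdist_triangle mX mY)).
have r20 : 0 < r / 2 by rewrite divr_gt0.
have [u [uz [u1 _]]] : exists u, nearby (pdist dX dY) z (r / 2) u /\
    (mck_ker (K_lam dX T dY S lam) (c, 0%N, 0%N) z' u =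
     mck_ker (K_lam dX T dY S lam) (c, 0%N, 0%N) z u /\
     mck_ker (K_lam dX T dY S lam) (c, 0%N, 0%N) u z' =
     mck_ker (K_lam dX T dY S lam) (c, 0%N, 0%N) u z).
  apply: contrapT => /forallNP nou.
  have : lam.-negligible (nearby (pdist dX dY) z (r / 2)).
    apply: negligibleS (tw (c, 0%N, 0%N)) => u zu /= eu; exact: (nou u).
  move/negligibleP => /(_ (measurable_nearby (measurable_pdist mX cX bX mY cY bY) _ _)).
  by have := sz _ r20 => /[swap] ->; rewrite ltxx.
move: u1; rewrite !kerE /= => u1; have := uz c.
have := pdist_triangle mX mY c z' u z; rewrite (pdistC mX mY c u z) u1; lra.
Qed.

Lemma twin_free_quotient_K_lam (lam : probability (X * Y)%type R)
    (Q : mck_space R (bool * nat * nat) (bool * nat * nat)) pi :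
  twin_free_quotient (K_lam dX T dY S lam) Q pi ->
  kernel_isomorphic (K_lam dX T dY S lam) Q.
Proof.
apply: twin_free_quotient_iso.
have [zs zsP] := pdist_dense mX cX mY cY.
apply: filterS (ae_support (pdistC mX mY) (pdist_triangle mX mY)
  (measurable_pdist mX cX bX mY cY bY) zsP lam) => z sz z'.
exact: twin_of_support.
Qed.
End joinings.

Theorem theorem6 (R : realType) (dx dy : measure_display)
  (X : measurableType dx) (Y : measurableType dy)
  (dX : X -> X -> R) (mu : probability X R) (T : X -> X)
  (dY : Y -> Y -> R) (nu : probability Y R) (S : Y -> Y)
  (lam lam' : probability (X * Y)%type R) :
  cmmps dX mu T -> cmmps dY nu S ->
  joining mu T nu S lam -> joining mu T nu S lam' ->
  (forall n m : nat, (0 < n)%N -> (0 < m)%N -> Phi_eq dX T dY S n m lam lam') ->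
  (forall (Q Q' : mck_space R (bool * nat * nat) (bool * nat * nat))
          (pi : X * Y -> mck_T Q) (pi' : X * Y -> mck_T Q'),
      twin_free_quotient (K_lam dX T dY S lam) Q pi ->
      twin_free_quotient (K_lam dX T dY S lam') Q' pi' ->
      kernel_isomorphic Q Q') /\
  (distance_array_pure dX T dY S lam -> distance_array_pure dX T dY S lam' ->
   exists U : X * Y -> X * Y,
     kernel_iso_via (K_lam dX T dY S lam) (K_lam dX T dY S lam') U).
Proof.
move=> sysX sysY lamJ _ PhiE.
have iso := array_laws_iso sysX sysY lamJ PhiE.
split=> [Q Q' pi pi' quo quo'|_ _]; last exact: iso.
apply: (@kernel_isomorphic_trans _ _ _ _ (K_lam dX T dY S lam)).
  exact/kernel_isomorphic_sym/(twin_free_quotient_K_lam sysX sysY quo).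
apply: kernel_isomorphic_trans iso _.
exact: (twin_free_quotient_K_lam sysX sysY quo').
Qed.
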